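(* Let $(G,\rho,\omega)$ be a reversible random network, where $\omega:E(G)\to\mathbb R_+$ is a random edge weight carried as a mark, with $\mathbb E[1/c^G_\rho]<\infty$ and such that almost surely \[ \lim_{R\to\infty}\frac{\log\log \mathrm{vol}^G(\rho,R)}{\log R}=0. \] Suppose moreover that $\mathbb E[\omega(X_0,X_1)^2]<\infty$, where $\{X_n\}$ is the random walk on $G$ started from $X_0=\rho$. Then for every $\delta>0$, almost surely, for all sufficiently large $n$, \[ \mathbb E\Big[\max_{0\le t\le n}\mathrm{dist}^G_\omega(X_0,X_t)^2\ \Big|\ (G,\rho,\omega)\Big]\le n^{1+\delta}. \]
   Context: A random rooted network $(G,\rho,c^G,\xi)$ consists of a random locally finite connected graph $G$ (self-loops allowed), a root $\rho$, edge conductances $c^G:E(G)\to[0,\infty)$ and a marking $\xi$ (here $\xi=\omega$). Write $c^G_u=\sum_{v:\{u,v\}\in E(G)}c^G(\{u,v\})$. The random walk $\{X_n\}$ has $X_0=\rho$ and $\Pr[X_{n+1}=v\mid X_n=u]=c^G(\{u,v\})/c^G_u$. The network is reversible if a.s. $c^G_\rho>0$ and $(G,X_0,X_1,c^G,\xi)$ and $(G,X_1,X_0,c^G,\xi)$ have the same law. $B^G(x,R)$ is the ball in the graph distance, $\mathrm{vol}^G(x,R)=\sum_{y\in B^G(x,R)}c^G_y$. $\omega(X_0,X_1)$ denotes $\omega(\{X_0,X_1\})$. $\mathrm{dist}^G_\omega$ is the $\omega$-weighted path (pseudo)metric: the infimum over paths in $G$ between two vertices of the sum of $\omega$ over the path's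 edges. *)

(* Defs.v *)
From HB Require Import structures.
From mathcomp Require Import all_boot all_order all_algebra.
From mathcomp Require Import all_classical all_reals all_analysis measurable_realfun.
Set Implicit Arguments.
Unset Strict Implicit.
Unset Printing Implicit Defensive.
Import Order.TTheory GRing.Theory Num.Def Num.Theory.
Import numFieldNormedType.Exports.
Local Open Scope classical_set_scope.
Local Open Scope ring_scope.

(* A (labelled) network: vertices are labelled by natural numbers; the graph
   G is the connected component of the root for the symmetric adjacency
   relation [adj] (self-loops allowed); [cond] are the conductances c^G and
   [wt] is the mark omega (edge weight).  Values of [cond]/[wt] on non-edges
   and of everything outside the root's component are irrelevant. *)
Record network (R : realType) := Network {
  adj : nat -> nat -> bool;
  cond : nat -> nat -> R;
  wt : nat -> nat -> R }.

Section Net.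
Variable R : realType.
Implicit Types (N : network R).

Definition nbrs N (u : nat) : set nat := [set v | adj N u v].

Definition cdeg N (u : nat) : R := \sum_(v \in nbrs N u) cond N u v.

Definition step N (u v : nat) : R :=
  if adj N u v then cond N u v / cdeg N u else 0.

Definition comp N (x : nat) : set nat :=
  [set y | exists s : seq nat, path (adj N) x s /\ last x s = y].

Definition gball N (x : nat) (r : nat) : set nat :=
  [set y | exists s : seq nat, [/\ path (adj N) x s, last x s = y & (size s <= r)%N]].

Definition vol N (x : nat) (r : nat) : R := \sum_(y \in gball N x r) cdeg N y.

Fixpoint pathwt N (x : nat) (s : seq nat) : R :=
  if s is y :: s' then wt N x y + pathwt N y s' else 0.

Definition wdist N (x y : nat) : R :=
  inf [set d | exists s : seq nat, [/\ path (adj N) x s, last x s = y & d = pathwt N x s]].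

(* Quenched expectation E_x[F(X_0,...,X_n)] for the random walk on N
   started at x, F a functional of the trajectory [:: X_0; ...; X_n]. *)
Fixpoint walkE N (n : nat) (x : nat) (F : seq nat -> R) : R :=
  if n is n'.+1 then
    \sum_(y \in nbrs N x) step N x y * walkE N n' y (fun s => F (x :: s))
  else F [:: x].

Definition wf_network N (rho : nat) : Prop :=
  forall u, comp N rho u ->
    finite_set (nbrs N u) /\
    forall v, adj N u v ->
      [/\ adj N v u, cond N u v = cond N v u, 0 <= cond N u v,
          wt N u v = wt N v u & 0 <= wt N u v].

Definition rooted_iso N (x : nat) N' (x' : nat) (phi : nat -> nat) : Prop :=
  [/\ phi x = x',
      {in comp N x &, injective phi},
      phi @` comp N x = comp N' x' &
      forall u v, comp N x u -> comp N x v ->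
        adj N' (phi u) (phi v) = adj N u v /\
        (adj N u v -> cond N' (phi u) (phi v) = cond N u v /\
                      wt N' (phi u) (phi v) = wt N u v)].

(* functionals of doubly-rooted networks which are invariant under
   isomorphism (i.e. functionals of isomorphism classes) *)
Definition iso_invariant (F : network R -> nat -> nat -> \bar R) : Prop :=
  forall N x y N' x' phi, rooted_iso N x N' x' phi -> comp N x y ->
    F N x y = F N' (phi x) (phi y).

Definition coord_sets : set (set (network R)) :=
  [set A | exists u v : nat,
      (exists b : bool, A = [set N | adj N u v = b]) \/
      (exists B : set R, measurable B /\
         (A = (fun N => cond N u v) @^-1` B \/ A = (fun N => wt N u v) @^-1` B))].

Definition net_measurable (f : network R -> \bar R) : Prop :=
  forall B : set (\bar R), measurable B -> <<s coord_sets >> (f @^-1` B).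

Definition random_network (d : measure_display) (Omega : measurableType d)
  (net : Omega -> network R) (rt : Omega -> nat) : Prop :=
  [/\ forall k, measurable (rt @^-1` [set k]),
      forall u v (b : bool), measurable [set w | adj (net w) u v = b],
      forall u v (B : set R), measurable B ->
        measurable ((fun w => cond (net w) u v) @^-1` B),
      forall u v (B : set R), measurable B ->
        measurable ((fun w => wt (net w) u v) @^-1` B) &
      forall w, wf_network (net w) (rt w)].

(* Reversibility: a.s. c_rho > 0 and (G,X0,X1,c,omega) has the same law as
   (G,X1,X0,c,omega), i.e. E[F(G,X0,X1)] = E[F(G,X1,X0)] for every
   nonnegative measurable isomorphism-invariant functional F. *)
Definition reversible (d : measure_display) (Omega : measurableType d)
  (P : probability Omega R) (net : Omega -> network R) (rt : Omega -> nat) : Prop :=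
  {ae P, forall w, 0 < cdeg (net w) (rt w)} /\
  forall F : network R -> nat -> nat -> \bar R,
    (forall N x y, (0 <= F N x y)%E) ->
    (forall x y, net_measurable (fun N => F N x y)) ->
    iso_invariant F ->
    (\int[P]_w (\big[adde/0%E]_(y \in nbrs (net w) (rt w))
                  ((step (net w) (rt w) y)%:E * F (net w) (rt w) y)%E))%E =
    (\int[P]_w (\big[adde/0%E]_(y \in nbrs (net w) (rt w))
                  ((step (net w) (rt w) y)%:E * F (net w) y (rt w))%E))%E.

End Net.

(* Main.v *)
Require Import Defs.
From HB Require Import structures.
From mathcomp Require Import all_boot all_order all_algebra finmap.
From mathcomp Require Import all_classical all_reals all_analysis measurable_realfun.
From mathcomp Require Import ring lra.
Set Implicit Arguments.
Unset Strict Implicit.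
Unset Printing Implicit Defensive.
Import Order.TTheory GRing.Theory Num.Def Num.Theory.
Import numFieldNormedType.Exports.
Local Open Scope classical_set_scope.
Local Open Scope ring_scope.

(** Let [f] be the distance to the root, [b(x)] and [h(x)] the mean and the mean
square of the increment of [f] in one step from [x].  As [exp (u - u^2) <= 1 + u + u^2],
the exponential of the sum along the walk of
[th * df - th^2 * df^2 - th * b(x) - th^2 * h(x)] is a supermartingale for every [th];
by reversibility so is its analogue along the reversed path.  In the half-sum of
the two exponents the drifts telescope, which leaves [th * (f(X_t) - f(X_0))] minus
[th^2] times a quadratic variation [Q].  Hence [f(X_t)^2 <= L * Q] except on an event
whose contribution is [exp (- L / 32)] times a polynomial in the length of the path
times the energy of the ball.  To bound that contribution in mean square with no
moment beyond the second one, the exponential martingales are only started at the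
first, and the reversed ones at the last, step whose size is comparable to
[f(X_t) / n]: these steps pay for the dyadic scale of [f(X_t)].

The mass transport principle, derived from reversibility for the [s]-step walk,
bounds the mean energy [E h(X_s)] by stationarity, and the energy of the part of the
ball reached in [s] steps by a polynomial in [s] times its volume.  The volume being
subexponential, [L] of order [n^e] suffices. *)

Local Notation comp := Defs.comp.

(** * Displacement of a reversible walk on a finite set *)

(** From [1 - u + u^2 <= exp (- (u - u^2))] by inversion, because [(1 - u + u^2) (1 + u + u^2) = 1 +
    u^2 + u^4] is at least one. *)
Lemma expR_le_quadratic (R : realType) (u : R) : expR (u - u ^+ 2) <= 1 + u + u ^+ 2.
Proof.
have h0 : 0 < 1 - (u - u ^+ 2) by nra.
have h1 : 1 - (u - u ^+ 2) <= expR (- (u - u ^+ 2)).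
  by have := expR_ge1Dx (- (u - u ^+ 2)).
rewrite -[X in expR X]opprK expRN.
rewrite -[leRHS]invrK lef_pV2 ?posrE ?invr_gt0 ?expR_gt0//; last by nra.
apply: le_trans h1.
rewrite -[leLHS]mulr1 mulrC ler_pdivrMr; last by nra.
nra.
Qed.

Lemma sum_nat_ord_cond (R : realType) n r r' (F : nat -> R) : (r' <= n)%N ->
  \sum_(i < n | (r <= i < r')%N) F i = \sum_(r <= i < r') F i.
Proof.
move=> r'n; rewrite (big_nat_widenl r 0)// (big_nat_widen 0 r' n)// big_mkord.
by apply: eq_bigl => i.
Qed.

Section FiniteWalk.
Context (R : realType) (V : finType) (p : V -> V -> R) (c : V -> R).
Hypothesis p_ge0 : forall x y, 0 <= p x y.
Hypothesis p_le1 : forall x, \sum_y p x y <= 1.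
Hypothesis c_ge0 : forall x, 0 <= c x.
Hypothesis p_rev : forall x y, c x * p x y = c y * p y x.

(** As [p] is only substochastic, this is the expectation for a walk that may be killed: paths
    leaving [V] contribute nothing. *)
Fixpoint pathE n x (F : seq V -> R) : R :=
  if n is n'.+1 then \sum_y p x y * pathE n' y (fun s => F (x :: s)) else F [:: x].

Lemma pathE_le n x F G : (forall t, size t = n -> F (x :: t) <= G (x :: t)) ->
  pathE n x F <= pathE n x G.
Proof.
elim: n x F G => [|n IH] x F G FG /=; first exact: FG.
apply: ler_sum => y _; rewrite ler_wpM2l// IH// => t tn.
by apply: FG; rewrite /= tn.
Qed.

Lemma eq_pathE n x F G : (forall t, size t = n -> F (x :: t) = G (x :: t)) ->
  pathE n x F = pathE n x G.
Proof. by move=> FG; apply/le_anti; rewrite !pathE_le// => t /FG ->. Qed.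

Lemma pathED n x F G : pathE n x (fun s => F s + G s) = pathE n x F + pathE n x G.
Proof.
elim: n x F G => //= n IH x F G.
by rewrite -big_split; apply: eq_bigr => y _; rewrite IH mulrDr.
Qed.

Lemma pathEZ n x a F : pathE n x (fun s => a * F s) = a * pathE n x F.
Proof.
elim: n x F => //= n IH x F.
by rewrite mulr_sumr; apply: eq_bigr => y _; rewrite IH mulrCA.
Qed.

Lemma pathE_sum n x (I : Type) (l : seq I) (F : I -> seq V -> R) :
  pathE n x (fun s => \sum_(i <- l) F i s) = \sum_(i <- l) pathE n x (F i).
Proof.
elim: l => [|i l IH].
  rewrite big_nil -[RHS](mul0r (pathE n x (fun=> 1))) -pathEZ.
  by apply: eq_pathE => t _; rewrite big_nil mul0r.
by rewrite big_cons -IH -pathED; apply: eq_pathE => t _; rewrite big_cons.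
Qed.

Lemma pathE_cst n x a : 0 <= a -> pathE n x (fun=> a) <= a.
Proof.
move=> a0; elim: n x => //= n IH x.
apply: (@le_trans _ _ (\sum_y p x y * a)).
  by apply: ler_sum => y _; rewrite ler_wpM2l.
by rewrite -mulr_suml ler_piMl.
Qed.

(** * Transfer operators with multiplicative weights, and their adjoints *)

Definition wop (k : V -> V -> R) (v : V -> R) x := \sum_y p x y * (k x y * v y).

(** Feynman-Kac operators with time-dependent weights: applied to [1] they give the expectation of a
    product of weights along the path ([pathE_prod]). *)
Fixpoint wops n (k : nat -> V -> V -> R) (v : V -> R) : V -> R :=
  if n is n'.+1 then wop (k 0%N) (wops n' (fun i => k i.+1) v) else v.

Definition avg (v : V -> R) x := \sum_y p x y * v y.

Lemma pathE_prod o n x (k : nat -> V -> V -> R) :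
  pathE n x (fun s => \prod_(i < n) k i (nth o s i) (nth o s i.+1)) =
  wops n k (fun=> 1) x.
Proof.
elim: n x k => [|n IH] x k /=; first by rewrite big_ord0.
apply: eq_bigr => y _; congr (_ * _).
rewrite -IH -pathEZ; apply: eq_pathE => t _.
by rewrite big_ord_recl.
Qed.

Lemma wop_le k v w x : (forall x y, 0 <= k x y) -> (forall y, v y <= w y) ->
  wop k v x <= wop k w x.
Proof. by move=> k0 vw; apply: ler_sum => y _; rewrite !ler_wpM2l. Qed.

Lemma wop_ge0 k v x : (forall x y, 0 <= k x y) -> (forall y, 0 <= v y) -> 0 <= wop k v x.
Proof. by move=> k0 v0; apply: sumr_ge0 => y _; rewrite !mulr_ge0. Qed.

Lemma wops_le1 n k x : (forall i x y, 0 <= k i x y) ->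
  (forall i x, wop (k i) (fun=> 1) x <= 1) -> wops n k (fun=> 1) x <= 1.
Proof.
elim: n k x => //= n IH k x k0 k1.
apply: le_trans (k1 0%N x).
by apply: wop_le => // y; apply: IH => i; [exact: k0|exact: k1].
Qed.

(** The weights after time [r] integrate out to at most one, starting from the last, and those
    before [r] are trivial, so only plain averaging up to the weight of step [r] survives. *)
Lemma wops_trunc n r k x : (r < n)%N -> (forall i x y, 0 <= k i x y) ->
  (forall i x y, (i < r)%N -> k i x y = 1) ->
  (forall i x, (r < i)%N -> wop (k i) (fun=> 1) x <= 1) ->
  wops n k (fun=> 1) x <= iter r avg (wop (k r) (fun=> 1)) x.
Proof.
elim: r n k x => [|r IH] [|n] k x //= rn k0 kr k1.
  apply: wop_le => // y; apply: wops_le1 => i; first exact: k0.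
  by move=> z; exact: k1.
apply: ler_sum => y _; rewrite kr// mul1r ler_wpM2l//.
apply: (IH n (fun i => k i.+1)) => // i z.
- by move=> u ir; exact: kr.
- by move=> ir; exact: k1.
Qed.

(** Reversibility of [p] with respect to [c]: in the inner product weighted by [c], the adjoint
    keeps [p] and transposes the weight. *)
Lemma wop_adj k u v : \sum_x c x * (u x * wop k v x) =
  \sum_x c x * (v x * wop (fun x y => k y x) u x).
Proof.
transitivity (\sum_x \sum_y c x * p x y * (k x y * u x * v y)).
  apply: eq_bigr => x _; rewrite /wop !mulr_sumr; apply: eq_bigr => y _; ring.
rewrite exchange_big; apply: eq_bigr => x _; rewrite /wop !mulr_sumr.
by apply: eq_bigr => y _ /=; rewrite p_rev; ring.
Qed.

(** The first [r] operators are moved one by one onto [u] by [wop_adj]. Their transposed weights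
    have mean at most one, so [u] stays between 0 and 1. The weights after [r] integrate out
    forwards, and step [r] remains, seen from its endpoint. *)
Lemma wops_rev n r k u : (r < n)%N -> (forall i x y, 0 <= k i x y) ->
  (forall i x, (i < r)%N -> wop (fun x y => k i y x) (fun=> 1) x <= 1) ->
  (forall i x, (r < i)%N -> wop (k i) (fun=> 1) x <= 1) ->
  (forall x, 0 <= u x <= 1) ->
  \sum_x c x * (u x * wops n k (fun=> 1) x) <=
  \sum_x c x * wop (fun x y => k r y x) (fun=> 1) x.
Proof.
elim: r n k u => [|r IH] [|n] k u //= rn k0 kl kr u01.
  apply: (@le_trans _ _ (\sum_x c x * (u x * wop (k 0%N) (fun=> 1) x))).
    apply: ler_sum => x _; rewrite ler_wpM2l// ler_wpM2l//; first by case/andP: (u01 x).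
    apply: wop_le => // y; apply: wops_le1 => i; first exact: k0.
    by move=> z; exact: kr.
  rewrite wop_adj; apply: ler_sum => x _; rewrite mul1r ler_wpM2l//.
  by apply: wop_le => // y; case/andP: (u01 y).
rewrite wop_adj.
set u' := wop _ u.
rewrite (eq_bigr (fun x => c x * (u' x * wops n (fun i => k i.+1) (fun=> 1) x))); last first.
  by move=> x _; rewrite [_ * u' x]mulrC.
apply: (IH n (fun i => k i.+1) u') => //.
- by move=> i x ir; exact: kl.
- by move=> i x ir; exact: kr.
- move=> x; rewrite /u' wop_ge0//=; last by move=> y; case/andP: (u01 y).
  apply: le_trans (kl 0%N x _) => //.
  by apply: wop_le => // y; case/andP: (u01 y).
Qed.

Lemma avg_le v w x : (forall y, v y <= w y) -> avg v x <= avg w x.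
Proof. by move=> vw; apply: ler_sum => y _; rewrite ler_wpM2l. Qed.

Lemma iter_avg_le r v w x : (forall y, v y <= w y) -> iter r avg v x <= iter r avg w x.
Proof. by move=> vw; elim: r x => //= r IH x; apply: avg_le. Qed.

Lemma iter_avg_ge0 r v x : (forall y, 0 <= v y) -> 0 <= iter r avg v x.
Proof.
by move=> v0; elim: r x => //= r IH x; apply: sumr_ge0 => y _; rewrite mulr_ge0.
Qed.

Lemma iter_avgZ r a v x : iter r avg (fun y => a * v y) x = a * iter r avg v x.
Proof.
elim: r x => //= r IH x; rewrite /avg mulr_sumr.
by apply: eq_bigr => y _; rewrite IH mulrCA.
Qed.

Lemma iter_avg_sum r (I : Type) (l : seq I) (v : I -> V -> R) x :
  iter r avg (fun y => \sum_(i <- l) v i y) x = \sum_(i <- l) iter r avg (v i) x.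
Proof.
elim: r x => //= r IH x; rewrite /avg.
transitivity (\sum_y \sum_(i <- l) p x y * iter r avg (v i) y).
  by apply: eq_bigr => y _; rewrite IH mulr_sumr.
by rewrite exchange_big.
Qed.

Lemma pathE_pair o n r x g : (r < n)%N -> (forall x y, 0 <= g x y) ->
  pathE n x (fun s => g (nth o s r) (nth o s r.+1)) <=
  iter r avg (wop g (fun=> 1)) x.
Proof.
move=> rn g0.
(* With weight one at every step but [r], the functional becomes a product to which [wops_trunc]
   applies. *)
pose k i x y := if i == r then g x y else 1 : R.
have -> : iter r avg (wop g (fun=> 1)) x = iter r avg (wop (k r) (fun=> 1)) x.
  by congr (iter r avg _ x); rewrite /k eqxx.
apply: le_trans (@wops_trunc n r k x rn _ _ _).
- rewrite -(pathE_prod o) le_eqVlt; apply/orP; left; apply/eqP; apply: eq_pathE => t _.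
  rewrite (bigD1 (Ordinal rn))//= big1 /k ?eqxx ?mulr1//.
  by move=> i /negbTE ir; rewrite -[_ == r]/(i == Ordinal rn) ir.
- by move=> i y z; rewrite /k; case: ifP.
- by move=> i y z ir; rewrite /k ltn_eqF.
- move=> i y ir; rewrite /k gtn_eqF// /wop.
  by under eq_bigr do rewrite !mulr1; exact: p_le1.
Qed.


(** * One-step exponential estimates for a function on the vertices *)

Section Lipschitz.
Variables (f : V -> R) (o : V).
Hypothesis f_ge0 : forall x, 0 <= f x.
Hypothesis fo : f o = 0.
Hypothesis co : 0 < c o.

Definition incr x y := f y - f x.
Definition drift x := \sum_y p x y * incr x y.
Definition energy x := \sum_y p x y * incr x y ^+ 2.

Lemma energy_ge0 x : 0 <= energy x.
Proof. by apply: sumr_ge0 => y _; rewrite mulr_ge0// sqr_ge0. Qed.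

Definition tilt (th : R) x y : R :=
  th * incr x y - th ^+ 2 * incr x y ^+ 2 - th * drift x - th ^+ 2 * energy x.

(* The tilt of the time-reversed walk and of the function [- f]. *)
Definition cotilt (th : R) x y : R :=
  th * incr x y - th ^+ 2 * incr x y ^+ 2 + th * drift y - th ^+ 2 * energy y.

(** Transposing a step changes the sign of its increment, so the adjoint of a [cotilt] weight is
    again a [tilt] weight and [wop_tilt] serves both directions. *)
Lemma cotiltE th x y : cotilt th y x = tilt (- th) x y.
Proof. by rewrite /cotilt /tilt /incr; ring. Qed.

(** The left side is minus a quarter of the total mass at worst, since [u + u^2 >= - 1/4] pointwise;
    the mass is at most one. *)
Lemma drift_energy (t : R) x : - (1 / 4) <= t * drift x + t ^+ 2 * energy x.
Proof.
rewrite /drift /energy !mulr_sumr -big_split/=.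
apply: (@le_trans _ _ (\sum_y p x y * - (1 / 4))).
  by rewrite -mulr_suml; have := p_le1 x; nra.
apply: ler_sum => y _; have := p_ge0 x y; set d := incr x y => p0.
have -> : t * (p x y * d) + t ^+ 2 * (p x y * d ^+ 2) = p x y * (t * d + (t * d) ^+ 2) by ring.
rewrite ler_wpM2l//; have := sqr_ge0 (t * d + 1 / 2); set u := t * d; nra.
Qed.

Lemma tilt_le th x y : tilt th x y <= 1 / 2.
Proof.
have := drift_energy th x; rewrite /tilt; set d := incr x y.
by have := sqr_ge0 (th * d - 1 / 2); nra.
Qed.

(** By [expR_le_quadratic] the mean is at most [(1 + B) exp (- B)], where [B] collects the drift and
    energy terms, and [1 + B <= exp B]. *)
Lemma wop_tilt th x : wop (fun x y => expR (tilt th x y)) (fun=> 1) x <= 1.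
Proof.
rewrite /wop.
pose B := th * drift x + th ^+ 2 * energy x.
apply: (@le_trans _ _ (\sum_y p x y *
    ((1 + th * incr x y + th ^+ 2 * incr x y ^+ 2) * expR (- B)))).
  apply: ler_sum => y _; rewrite ler_wpM2l// mulr1.
  have -> : tilt th x y = (th * incr x y - (th * incr x y) ^+ 2) + - B.
    by rewrite /tilt /B; ring.
  rewrite expRD ler_wpM2r ?expR_ge0// -exprMn; exact: expR_le_quadratic.
under eq_bigr do rewrite mulrA.
rewrite -mulr_suml.
have -> : \sum_y p x y * (1 + th * incr x y + th ^+ 2 * incr x y ^+ 2) = \sum_y p x y + B.
  rewrite /B /drift /energy !mulr_sumr -!big_split/=.
  by apply: eq_bigr => y _; ring.
apply: (@le_trans _ _ (expR B * expR (- B))); last by rewrite -expRD subrr expR0.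
rewrite ler_wpM2r ?expR_ge0//.
apply: le_trans (expR_ge1Dx B); by rewrite lerD2r.
Qed.

Lemma wop1 x : wop (fun _ _ => 1) (fun=> 1) x <= 1.
Proof. by rewrite /wop; under eq_bigr do rewrite !mulr1; exact: p_le1. Qed.

(** * Displacement up to a fixed time *)

Section Fixed_length.
Variable n : nat.
Hypothesis n_gt0 : (0 < n)%N.

Definition scale j : R := 2 ^+ j.

(** The indicator of a step that is at least a [1 / (2 n)] fraction of the dyadic scale [2^j]. *)
Definition large j x y : R := (scale j <= 2 * n%:R * `|incr x y|)%R%:R.

Lemma large_ge0 j x y : 0 <= large j x y.
Proof. exact: ler0n. Qed.

(** Only the scales below [z = 2 n |incr|] count, and their squares form a geometric sum dominated
    by its last term. A large step thus pays for all scales by its own square, uniformly in [J]. *)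
Lemma sum_large J x y :
  \sum_(j < J) scale j ^+ 2 * large j x y <= 8 * n%:R ^+ 2 * incr x y ^+ 2.
Proof.
have G (z : R) K : \sum_(j < K) scale j ^+ 2 * (scale j <= z)%R%:R <= scale K ^+ 2 / 3.
  elim: K => [|K IH]; first by rewrite big_ord0 /scale expr0; lra.
  rewrite big_ord_recr/=; apply: (le_trans (lerD IH (lexx _))).
  have s0 : 0 < scale K by rewrite exprn_gt0.
  have -> : scale K.+1 = 2 * scale K by rewrite /scale exprS.
  by case: (leP (scale K) z) => _; rewrite ?mulr1 ?mulr0; nra.
have H (z : R) : 0 <= z -> \sum_(j < J) scale j ^+ 2 * (scale j <= z)%R%:R <= 2 * z ^+ 2.
  move=> z0; elim: J => [|K IH]; first by rewrite big_ord0 mulr_ge0// sqr_ge0.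
  rewrite big_ord_recr/=.
  have s0 : 0 < scale K by rewrite exprn_gt0.
  case: (leP (scale K) z) => Kz; last by rewrite mulr0 addr0.
  by apply: (le_trans (lerD (G z K) (lexx _))); rewrite mulr1; nra.
have := H (2 * n%:R * `|incr x y|); rewrite !mulr_ge0// => /(_ isT) /le_trans; apply.
by rewrite !exprMn real_normK ?num_real//; nra.
Qed.

Variable L : R.
Hypothesis L_gt0 : 0 < L.

(** For a displacement [a], the exponent [th * a / 2 - th^2 * a^2 / L] is maximal at
    [th = L / (4 a)]; this is that value for [a = 2^(j+1)], good enough for all [a] between [2^j]
    and [2^(j+1)]. *)
Definition theta j : R := L / 8 / scale j.

(** The indicator of a large step sits at the start [r] of the window, the step that [wops_trunc]
    retains; in [bwd] it sits at the end [r'], the step that [wops_rev] retains. *)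
Definition fwd j r r' i x y : R :=
  (if i == r then large j x y else 1) *
  expR (if (r <= i < r'.+1)%N then tilt (theta j) x y else 0).

Definition bwd j r r' i x y : R :=
  (if i == r' then large j x y else 1) *
  expR (if (r <= i < r'.+1)%N then cotilt (theta j) x y else 0).

Definition qvar (s : seq V) : R := \sum_(i < n)
  (incr (nth o s i) (nth o s i.+1) ^+ 2 + energy (nth o s i) + energy (nth o s i.+1)).

Definition energy_sum := \sum_(i < n.+1) iter i (avg) energy o.
Definition energy_mass := \sum_x c x * energy x.

Lemma fwd_ge0 j r r' i x y : 0 <= fwd j r r' i x y.
Proof. by rewrite mulr_ge0 ?expR_ge0//; case: ifP. Qed.

Lemma bwd_ge0 j r r' i x y : 0 <= bwd j r r' i x y.
Proof. by rewrite mulr_ge0 ?expR_ge0//; case: ifP. Qed.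

Lemma wop_scale_le (k g : V -> V -> R) (a : R) x : (forall y, k x y <= a * g x y) ->
  wop k (fun=> 1) x <= a * wop g (fun=> 1) x.
Proof.
move=> kg; rewrite /wop mulr_sumr; apply: ler_sum => y _.
by rewrite [leRHS]mulrCA ler_wpM2l// !mulr1.
Qed.

(** [wops_trunc] leaves the step [r], whose tilt costs a factor [exp (1 / 2)]; summing the
    indicators over the scales by [sum_large] turns it into the energy at time [r]. *)
Lemma fwd_sum J r r' : (r <= r')%N -> (r' < n)%N ->
  \sum_(j < J) scale j ^+ 2 * wops n (fwd j r r') (fun=> 1) o <=
  expR (1 / 2) * (8 * n%:R ^+ 2) * iter r avg energy o.
Proof.
move=> rr' r'n.
have rn : (r < n)%N by exact: leq_ltn_trans r'n.
apply: (@le_trans _ _ (\sum_(j < J) scale j ^+ 2 *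
    (expR (1 / 2) * iter r avg (wop (large j) (fun=> 1)) o))).
  apply: ler_sum => j _; rewrite ler_wpM2l ?sqr_ge0//.
  apply: (le_trans (@wops_trunc n r _ o rn (@fwd_ge0 j r r') _ _)).
  - by move=> i x y ir; rewrite /fwd ltn_eqF// leqNgt ir expR0 mulr1.
  - move=> i x ir; rewrite /fwd gtn_eqF//; case: (r <= i < r'.+1)%N.
      by rewrite /wop; under eq_bigr do rewrite mul1r; exact: wop_tilt.
    by rewrite /wop; under eq_bigr do rewrite expR0 mul1r; exact: wop1.
  - rewrite -iter_avgZ; apply: iter_avg_le => x; apply: wop_scale_le => y.
    rewrite /fwd eqxx leqnn ltnS rr' mulrC ler_wpM2r ?large_ge0//.
    by rewrite ler_expR tilt_le.
rewrite -iter_avgZ.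
under eq_bigr do rewrite mulrA -iter_avgZ.
rewrite -iter_avg_sum; apply: iter_avg_le => x.
rewrite /energy /wop.
apply: (@le_trans _ _ (\sum_y expR (1/2) * (p x y * \sum_(j < J) scale j ^+ 2 * large j x y))).
  rewrite le_eqVlt; apply/orP; left; apply/eqP.
  under eq_bigr do rewrite mulr_sumr.
  rewrite exchange_big; apply: eq_bigr => y _ /=; rewrite !mulr_sumr.
  by apply: eq_bigr => j _; rewrite mulr1; ring.
rewrite mulr_sumr; apply: ler_sum => y _.
rewrite -mulrA ler_wpM2l ?expR_ge0// mulrCA ler_wpM2l//; exact: sum_large.
Qed.

(** The time-reversed version, from [wops_rev] with [u] the indicator of [o]. The starting point is
    forgotten on reversal, so the energy of all of [V] appears, normalised by [c o]. *)
Lemma bwd_sum J r r' : (r <= r')%N -> (r' < n)%N ->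
  \sum_(j < J) scale j ^+ 2 * wops n (bwd j r r') (fun=> 1) o <=
  expR (1 / 2) * (8 * n%:R ^+ 2) * (energy_mass / c o).
Proof.
move=> rr' r'n.
rewrite [leRHS]mulrA ler_pdivlMr// mulr_suml.
apply: (@le_trans _ _ (\sum_(j < J) scale j ^+ 2 *
    (expR (1 / 2) * \sum_x c x * wop (fun x y => large j y x) (fun=> 1) x))).
  apply: ler_sum => j _; rewrite -mulrA ler_wpM2l ?sqr_ge0//.
  have -> : wops n (bwd j r r') (fun=> 1) o * c o =
      \sum_x c x * ((x == o)%:R * wops n (bwd j r r') (fun=> 1) x).
    rewrite (bigD1 o)//= eqxx mul1r big1 ?addr0 1?mulrC// => x /negbTE ->.
    by rewrite mul0r mulr0.
  apply: (le_trans (@wops_rev n r' _ _ r'n (@bwd_ge0 j r r') _ _ _)).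
  - move=> i x ir; rewrite /bwd ltn_eqF//; case: (r <= i < r'.+1)%N; rewrite /wop.
      by under eq_bigr do rewrite mul1r cotiltE; exact: wop_tilt.
    by under eq_bigr do rewrite expR0 mul1r; exact: wop1.
  - move=> i x ir; rewrite /bwd gtn_eqF// ltnS [(i <= r')%N]leqNgt ir andbF /wop.
    by under eq_bigr do rewrite expR0 mul1r; exact: wop1.
  - by move=> x; case: (x == o); rewrite lexx ler01.
  - rewrite mulr_sumr; apply: ler_sum => x _; rewrite mulrCA ler_wpM2l//.
    apply: wop_scale_le => y.
    rewrite /bwd eqxx rr' ltnSn mulrC ler_wpM2r ?large_ge0//.
    by rewrite ler_expR cotiltE tilt_le.
rewrite -mulrA.
under eq_bigr do rewrite mulrCA.
rewrite -mulr_sumr ler_wpM2l ?expR_ge0//.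
under eq_bigr do rewrite mulr_sumr.
rewrite exchange_big/= /energy_mass mulr_sumr; apply: ler_sum => x _.
under eq_bigr do rewrite mulrCA.
rewrite -mulr_sumr mulrCA ler_wpM2l// /energy /wop.
under eq_bigr do rewrite mulr_sumr.
rewrite exchange_big mulr_sumr/=; apply: ler_sum => y _.
under eq_bigr do rewrite mulrCA mulr1.
rewrite -mulr_sumr mulrCA ler_wpM2l//.
apply: (le_trans (sum_large J y x)).
by rewrite /incr -[_ - f y]opprB sqrrN.
Qed.

(** In the half-sum the drifts telescope to the two ends of the window. Each boundary drift is
    absorbed by half the energy at its vertex, at the cost of [1 / 8] by [drift_energy]; this is why
    [qvar] carries the energies in full and not halved. *)
Lemma tilt_cotilt_sum (X : nat -> V) th r r' : (r <= r')%N ->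
  th * (f (X r'.+1) - f (X r)) - th ^+ 2 * (\sum_(r <= i < r'.+1)
     (incr (X i) (X i.+1) ^+ 2 + energy (X i) + energy (X i.+1))) - 1 / 4 <=
  (\sum_(r <= i < r'.+1) tilt th (X i) (X i.+1) +
   \sum_(r <= i < r'.+1) cotilt th (X i) (X i.+1)) / 2.
Proof.
move=> rr'.
set A := \sum_(r <= i < r'.+1) incr (X i) (X i.+1) ^+ 2.
set B := \sum_(r <= i < r'.+1) energy (X i).
set C := \sum_(r <= i < r'.+1) energy (X i.+1).
have -> : \sum_(r <= i < r'.+1) (incr (X i) (X i.+1) ^+ 2 + energy (X i) + energy (X i.+1))
    = A + B + C by rewrite /A /B /C -!big_split.
have -> : \sum_(r <= i < r'.+1) tilt th (X i) (X i.+1) +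
   \sum_(r <= i < r'.+1) cotilt th (X i) (X i.+1) =
   2 * th * (f (X r'.+1) - f (X r)) - 2 * th ^+ 2 * A - th ^+ 2 * B - th ^+ 2 * C
   + th * (drift (X r'.+1) - drift (X r)).
  rewrite -(telescope_sumr (fun i => f (X i)) (leqW rr')).
  rewrite -(telescope_sumr (fun i => drift (X i)) (leqW rr')).
  rewrite /A /B /C !mulr_sumr -!sumrN -!big_split/=; apply: eq_bigr => i _.
  by rewrite /tilt /cotilt /incr; ring.
have Br : energy (X r) <= B.
  by rewrite /B big_ltn// lerDl sumr_ge0// => i _; exact: energy_ge0.
have Cr : energy (X r'.+1) <= C.
  by rewrite /C big_nat_recr//= lerDr sumr_ge0// => i _; exact: energy_ge0.
have := drift_energy th (X r'.+1); have := drift_energy (- th) (X r).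
have := sqr_ge0 th; nra.
Qed.

Lemma incr_bound (X : nat -> V) (e : R) m k : (m <= k)%N ->
  (forall i, (m <= i < k)%N -> `|incr (X i) (X i.+1)| <= e) ->
  f (X k) - f (X m) <= (k - m)%:R * e.
Proof.
move=> mk Xe; rewrite -(telescope_sumr (fun i => f (X i)) mk).
apply: (@le_trans _ _ (\sum_(m <= i < k) e)).
  by rewrite big_nat [leRHS]big_nat; apply: ler_sum => i /Xe; apply: le_trans; exact: ler_norm.
by rewrite big_const_nat iter_addr addr0 mulr_natl.
Qed.

Definition path_prod (k : nat -> V -> V -> R) (s : seq V) : R :=
  \prod_(i < n) k i (nth o s i) (nth o s i.+1).

Lemma path_prodE (g : V -> V -> R) (T : nat -> V -> V -> R) q r r' (s : seq V) :
  (r' < n)%N -> g (nth o s q) (nth o s q.+1) = 1 ->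
  path_prod (fun i x y => (if i == q then g x y else 1) *
      expR (if (r <= i < r'.+1)%N then T i x y else 0)) s =
  expR (\sum_(r <= i < r'.+1) T i (nth o s i) (nth o s i.+1)).
Proof.
move=> r'n g1; rewrite /path_prod big_split/= big1 ?mul1r; last first.
  by move=> i _; case: eqP => // ->.
rewrite -expR_sum -big_mkcond/=.
by rewrite (@sum_nat_ord_cond _ _ _ _ (fun i => T i (nth o s i) (nth o s i.+1))).
Qed.

Lemma scale_exists (a : R) J : 1 <= a -> a < scale J ->
  exists2 j, (j < J)%N & scale j <= a < scale j.+1.
Proof.
move=> a1; elim: J => [|J IH] aJ; first by move: aJ; rewrite /scale expr0 ltNge a1.
have [Ja|aJ'] := leP (scale J) a; first by exists J => //; rewrite Ja.
by have [j jJ ja] := IH aJ'; exists j => //; exact: leqW.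
Qed.

(** If the squared displacement exceeds both 1 and [L * qvar s], a suitable window [(r, r')] and
    scale [j] make the corresponding term at least its square. The sum over all windows and scales
    is a union bound. *)
Lemma path_bound (s : seq V) J t : nth o s 0 = o -> (t <= n)%N ->
  (forall x, f x < scale J) ->
  f (nth o s t) ^+ 2 <= 1 + L * qvar s +
    \sum_(r < n) \sum_(r' < n | (r <= r')%N) \sum_(j < J)
      2 * expR (1 / 4 - L / 32) * (scale j ^+ 2 *
         (path_prod (fwd j r r') s + path_prod (bwd j r r') s)).
Proof.
move=> s0 tn fJ; set X := nth o s; set a := f (X t).
have q0 : 0 <= qvar s.
  by apply: sumr_ge0 => i _; rewrite !addr_ge0 ?sqr_ge0 ?energy_ge0.
have term0 r r' j : 0 <= 2 * expR (1 / 4 - L / 32) * (scale j ^+ 2 *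
         (path_prod (fwd j r r') s + path_prod (bwd j r r') s)).
  apply: mulr_ge0; first by rewrite mulr_ge0 ?expR_ge0.
  apply: mulr_ge0; first exact: sqr_ge0.
  apply: addr_ge0; apply: prodr_ge0 => i _; first exact: fwd_ge0.
  exact: bwd_ge0.
have Lq0 : 0 <= L * qvar s by rewrite mulr_ge0// ltW.
set T := \sum_(r < n) _.
have T0 : 0 <= T by do 3! (apply: sumr_ge0 => ? _).
have [a1|a1] := leP (a ^+ 2) 1; first by lra.
have [aq|aq] := leP (a ^+ 2) (L * qvar s); first by lra.
have a0 : 0 <= a by exact: f_ge0.
have {}a1 : 1 <= a by nra.
have nR : 0 < n%:R :> R by rewrite ltr0n.
have [j jJ /andP[ja aj]] := scale_exists a1 (fJ (X t)).
pose e : R := a / (2 * n%:R).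
have en : n%:R * e = a / 2 by rewrite /e; field; rewrite lt0r_neq0.
have e0 : 0 < e by rewrite divr_gt0 ?mulr_gt0//; lra.
(* The steps outside the window from the first to the last step of size at least [e]
   move the walk by at most [a / 2] in total. *)
pose P i := (i < t)%N && (e <= `|incr (X i) (X i.+1)|).
have fX0 : f (X 0%N) = 0 by rewrite /X s0.
have exP : exists i, P i.
  apply: contrapT => /forallNP nP.
  have : f (X t) - f (X 0%N) <= (t - 0)%:R * e.
    apply: incr_bound => // i /andP[_ it].
    by have /negP := nP i; rewrite /P it/= -ltNge => /ltW.
  rewrite fX0 subr0 subn0 -/a => at_e.
  have : t%:R * e <= n%:R * e by rewrite ler_wpM2r ?ler_nat// ltW.
  lra.
have Pt i : P i -> (i <= t)%N by case/andP => /ltnW.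
case: (ex_minnP exP) => r /andP[rt re] rmin.
case: (ex_maxnP exP Pt) => r' /andP[r't r'e] rmax.
have rr' : (r <= r')%N by apply: rmin; rewrite /P r't.
have r'n : (r' < n)%N by exact: leq_trans tn.
have rn : (r < n)%N by exact: leq_trans tn.
have D1 : f (X r) - f (X 0%N) <= (r - 0)%:R * e.
  apply: incr_bound => // i /andP[_ ir].
  rewrite leNgt; apply/negP => /ltW ei.
  have : (r <= i)%N by apply: rmin; rewrite /P ei (ltn_trans ir rt).
  by rewrite leqNgt ir.
have D2 : f (X t) - f (X r'.+1) <= (t - r'.+1)%:R * e.
  apply: incr_bound => // i /andP[r'i it].
  rewrite leNgt; apply/negP => /ltW ei.
  have : (i <= r')%N by apply: rmax; rewrite /P ei it.
  by rewrite leqNgt r'i.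
have D : a / 2 <= f (X r'.+1) - f (X r).
  have : (r - 0)%:R * e + (t - r'.+1)%:R * e <= n%:R * e.
    rewrite -mulrDl -natrD ler_wpM2r ?ler_nat// ?(ltW e0)// subn0.
    apply: leq_trans tn; rewrite -[leqRHS](subnKC r't) leq_add2r; exact: leqW.
  by move: D1 D2; rewrite fX0 -/a; lra.
have sj0 : 0 < scale j by rewrite exprn_gt0.
(* As [scale j <= a = 2 n e], every step of size at least [e] counts as large at scale [j]. *)
have lg i : e <= `|incr (X i) (X i.+1)| -> large j (X i) (X i.+1) = 1.
  move=> ei; rewrite /large; suff -> : scale j <= 2 * n%:R * `|incr (X i) (X i.+1)| by [].
  by apply: (le_trans ja); rewrite -ler_pdivrMl ?mulr_gt0// mulrC.
apply: (@le_trans _ _ (2 * expR (1 / 4 - L / 32) * (scale j ^+ 2 *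
         (path_prod (fwd j r r') s + path_prod (bwd j r r') s)))); last first.
  apply: (@le_trans _ _ T); last by lra.
  (* All terms being nonnegative, the term of the window and scale just found is at most the full
     sum. *)
  rewrite /T (bigD1 (Ordinal rn))//= (bigD1 (Ordinal r'n))//= (bigD1 (Ordinal jJ))//=.
  rewrite -!addrA lerDl !addr_ge0//.
  - by apply: sumr_ge0 => ? _.
  - by do 2! (apply: sumr_ge0 => ? _).
  - by do 3! (apply: sumr_ge0 => ? _).
rewrite (path_prodE (fun i => tilt (theta j))) ?lg//.
rewrite (path_prodE (fun i => cotilt (theta j))) ?lg//.
have := tilt_cotilt_sum X (theta j) rr'.
set Y1 := \sum_(r <= i < r'.+1) tilt _ _ _.
set Y2 := \sum_(r <= i < r'.+1) cotilt _ _ _.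
set Q := \sum_(r <= i < r'.+1) _ => YQ.
have Qq : Q <= qvar s.
  rewrite /Q -(@sum_nat_ord_cond _ n r r'.+1 (fun i =>
    incr (X i) (X i.+1) ^+ 2 + energy (X i) + energy (X i.+1)))// /qvar.
  rewrite [leRHS](bigID (fun i : 'I_n => (r <= i < r'.+1)%N))/= lerDl.
  by apply: sumr_ge0 => i _; rewrite !addr_ge0 ?sqr_ge0 ?energy_ge0.
(* With [z = a / 2^j] between 1 and 2, the exponent is at least [L (4 z - z^2) / 64], and
   [(z - 1) (2 - z) >= 0] bounds this below by [L (z + 2) / 64 >= L / 32]. *)
have key : L / 32 - 1 / 4 <= (Y1 + Y2) / 2.
  apply: le_trans YQ; rewrite lerD2r.
  pose z := a / scale j.
  have az : a = z * scale j by rewrite /z divfK// gt_eqF.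
  have z1 : 1 <= z by rewrite /z ler_pdivlMr// mul1r.
  have z2 : z <= 2 by rewrite /z ler_pdivrMr//; apply/ltW; rewrite -[2]/(2 ^+ 1) -exprD.
  have th0 : 0 < theta j by rewrite /theta !divr_gt0.
  have t1 : L / 16 * z <= theta j * (f (X r'.+1) - f (X r)).
    have -> : L / 16 * z = theta j * (a / 2).
      by rewrite az /theta; field; rewrite gt_eqF.
    by rewrite ler_wpM2l// ltW.
  have t2 : theta j ^+ 2 * Q <= L / 64 * z ^+ 2.
    have -> : L / 64 * z ^+ 2 = theta j ^+ 2 * (a ^+ 2 / L).
      by rewrite az /theta; field; rewrite !gt_eqF.
    rewrite ler_wpM2l ?sqr_ge0// ler_pdivlMr// mulrC.
    by apply: le_trans (ltW aq); rewrite ler_wpM2l// ltW.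
  apply: (@le_trans _ _ (L / 16 * z - L / 64 * z ^+ 2)); last by apply: lerB.
  have : 0 <= L * ((z - 1) * (2 - z)) by rewrite mulr_ge0 ?(ltW L_gt0)// mulr_ge0 ?subr_ge0.
  have : 0 <= L * z by rewrite mulr_ge0 ?(ltW L_gt0)// (le_trans _ z1).
  lra.
(* The control is on the half-sum of the exponents, the means on each exponential separately; the
   arithmetic-geometric inequality passes from one to the other. *)
have amgm : 2 * expR ((Y1 + Y2) / 2) <= expR Y1 + expR Y2.
  have -> : (Y1 + Y2) / 2 = Y1 / 2 + Y2 / 2 by lra.
  rewrite expRD; have E (y : R) : expR y = expR (y / 2) ^+ 2.
    by rewrite expr2 -expRD -splitr.
  rewrite (E Y1) (E Y2); have := sqr_ge0 (expR (Y1 / 2) - expR (Y2 / 2)); nra.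
have E1 : 1 <= expR (1 / 4 - L / 32) * expR ((Y1 + Y2) / 2).
  by rewrite -expRD -[leLHS]expR0 ler_expR; lra.
have aa : a ^+ 2 <= 4 * scale j ^+ 2.
  have : a <= 2 * scale j by apply/ltW; rewrite -[2 * _]exprS.
  nra.
have eg := expR_ge0 (1 / 4 - L / 32).
apply: (le_trans aa).
apply: (@le_trans _ _ (4 * scale j ^+ 2 * (expR (1 / 4 - L / 32) * expR ((Y1 + Y2) / 2)))).
  by rewrite ler_peMr// mulr_ge0// sqr_ge0.
have -> : 4 * scale j ^+ 2 * (expR (1 / 4 - L / 32) * expR ((Y1 + Y2) / 2)) =
  2 * expR (1 / 4 - L / 32) * (scale j ^+ 2 * (2 * expR ((Y1 + Y2) / 2))) by ring.
by rewrite ler_wpM2l ?mulr_ge0// ler_wpM2l// sqr_ge0.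
Qed.

Lemma qvar_mean : pathE n o qvar <= 3 * energy_sum.
Proof.
rewrite /qvar pathE_sum.
have -> : energy_sum = energy o + \sum_(i < n) iter i.+1 avg energy o.
  by rewrite /energy_sum big_ord_recl.
(* The squared increment of step [i] and the energy at its start each contribute the mean energy at
   time [i], the energy at its end that at time [i + 1]. *)
apply: (@le_trans _ _ (\sum_(i < n) (2 * iter i avg energy o + iter i.+1 avg energy o))).
  apply: ler_sum => i _; rewrite !pathED mulr2n mulrDl mul1r.
  apply: lerD; first apply: lerD.
  - apply: (le_trans (pathE_pair (g := fun x y => incr x y ^+ 2) o o (ltn_ord i) _)).
      by move=> x y; exact: sqr_ge0.
    apply: iter_avg_le => x; rewrite /wop /energy.
    by under eq_bigr do rewrite mulr1.
  - apply: (le_trans (pathE_pair (g := fun x y => energy x) o o (ltn_ord i) _)).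
      by move=> x y; exact: energy_ge0.
    apply: iter_avg_le => x; rewrite /wop -mulr_suml mulr1.
    by rewrite ler_piMl ?energy_ge0.
  - apply: (le_trans (pathE_pair (g := fun x y => energy y) o o (ltn_ord i) _)).
      by move=> x y; exact: energy_ge0.
    rewrite iterSr; apply: iter_avg_le => x; rewrite /wop /avg.
    by under eq_bigr do rewrite mulr1.
rewrite big_split/= -mulr_sumr.
have e0 i : 0 <= iter i avg energy o by apply: iter_avg_ge0 => x; exact: energy_ge0.
have : \sum_(i < n) iter i avg energy o <= energy o + \sum_(i < n) iter i.+1 avg energy o.
  have -> : energy o + \sum_(i < n) iter i.+1 avg energy o =
    \sum_(i < n.+1) iter i avg energy o by rewrite big_ord_recl.
  by rewrite big_ord_recr/= lerDl.
have : 0 <= energy o by exact: energy_ge0.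
lra.
Qed.

Theorem max_displacement :
  pathE n o (fun s => \big[Num.max/0]_(x <- s) f x ^+ 2) <=
  1 + 3 * L * energy_sum +
  n%:R ^+ 4 * (16 * expR (1 - L / 32)) * (energy_sum + energy_mass / c o).
Proof.
(* Any dyadic bound of [f] on the finite set will do: the sums over scales are bounded independently
   of [J]. *)
have [J fJ] : exists J, forall x, f x < scale J.
  pose B := \sum_x f x.
  exists (Num.bound B) => x.
  have xB : f x <= B by rewrite /B (bigD1 x)//= lerDl sumr_ge0.
  apply: (le_lt_trans xB); apply: (lt_le_trans (archi_boundP _)).
    by rewrite sumr_ge0.
  by rewrite /scale -natrX ler_nat ltnW// ltn_expl.
have E0 : 0 <= energy_sum.
  by rewrite sumr_ge0// => i _; apply: iter_avg_ge0 => x; exact: energy_ge0.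
have M0 : 0 <= energy_mass / c o.
  rewrite divr_ge0 ?(ltW co)// sumr_ge0// => x _; rewrite mulr_ge0//; exact: energy_ge0.
apply: (le_trans (pathE_le (G := fun s => 1 + L * qvar s +
    \sum_(r < n) \sum_(r' < n | (r <= r')%N) \sum_(j < J)
      2 * expR (1 / 4 - L / 32) * (scale j ^+ 2 *
         (path_prod (fwd j r r') s + path_prod (bwd j r r') s))) _)).
  move=> t tn; rewrite big_seq; elim/big_ind: _.
  - by have := path_bound (t := 0) (erefl : nth o (o :: t) 0 = o) (leq0n n) fJ;
      apply: le_trans; exact: sqr_ge0.
  - by move=> x y xb yb; rewrite ge_max xb.
  - move=> x /(nthP o)[i]; rewrite /= ltnS tn => ni <-.
    exact: path_bound.
rewrite !pathED pathEZ; apply: lerD.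
  apply: lerD; first exact: pathE_cst.
  by rewrite [3 * L]mulrC -mulrA ler_wpM2l ?(ltW L_gt0)// qvar_mean.
set W := energy_sum + _.
rewrite pathE_sum.
(* The constants: [2 * 8 = 16], and [exp (1 / 4)] from the drifts times [exp (1 / 2)] from the large
   step is at most [exp 1]. *)
have bound r r' : (r <= r')%N -> (r' < n)%N ->
  pathE n o (fun s => \sum_(j < J) 2 * expR (1 / 4 - L / 32) * (scale j ^+ 2 *
         (path_prod (fwd j r r') s + path_prod (bwd j r r') s))) <=
  16 * expR (1 - L / 32) * n%:R ^+ 2 * W.
  move=> rr' r'n; rewrite pathE_sum.
  under eq_bigr do rewrite pathEZ pathEZ pathED !pathE_prod mulrDr.
  rewrite -mulr_sumr big_split/=.
  have := lerD (fwd_sum J rr' r'n) (bwd_sum J rr' r'n).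
  rewrite -mulrDr => fb.
  have rE : iter r avg energy o <= energy_sum.
    have rn : (r < n.+1)%N by rewrite ltnS (leq_trans rr')// ltnW.
    rewrite /energy_sum (bigD1 (Ordinal rn))//= lerDl sumr_ge0// => i _.
    by apply: iter_avg_ge0 => x; exact: energy_ge0.
  have eL : expR (1 / 4 - L / 32) * expR (1 / 2) <= expR (1 - L / 32).
    by rewrite -expRD ler_expR; lra.
  have e1 := expR_ge0 (1 / 4 - L / 32).
  apply: (@le_trans _ _ (2 * expR (1 / 4 - L / 32) * (expR (1 / 2) * (8 * n%:R ^+ 2) * W))).
    rewrite ler_wpM2l ?mulr_ge0//; apply: (le_trans fb).
    by rewrite ler_wpM2l ?lerD2r// !mulr_ge0// ?expR_ge0// sqr_ge0.
  have -> : 2 * expR (1 / 4 - L / 32) * (expR (1 / 2) * (8 * n%:R ^+ 2) * W) =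
    16 * (expR (1 / 4 - L / 32) * expR (1 / 2)) * n%:R ^+ 2 * W by ring.
  rewrite ler_wpM2r ?addr_ge0// ler_wpM2r ?sqr_ge0// ler_wpM2l//.
set K := 16 * expR (1 - L / 32) * n%:R ^+ 2 * W.
have K0 : 0 <= K by rewrite /K !mulr_ge0 ?expR_ge0 ?sqr_ge0 ?addr_ge0.
(* There are at most [n^2] windows, each bounded by a multiple of [n^2], whence the power [n^4]. *)
apply: (@le_trans _ _ (\sum_(r < n) \sum_(r' < n) K)).
  apply: ler_sum => r _.
  rewrite (eq_pathE (G := fun s => \sum_(r' <- [seq i : 'I_n <- enum 'I_n | (r <= i)%N])
     \sum_(j < J) 2 * expR (1 / 4 - L / 32) * (scale j ^+ 2 *
         (path_prod (fwd j r r') s + path_prod (bwd j r r') s)))); last first.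
    by move=> t _; rewrite big_filter big_enum_cond.
  rewrite pathE_sum big_filter big_enum_cond big_mkcond/=.
  apply: ler_sum => r' _; case: ifP => [rr'|_ //]; exact: bound.
rewrite !sumr_const !card_ord -(mulr_natl (K *+ n)) -(mulr_natl K) le_eqVlt.
apply/orP; left; apply/eqP.
rewrite /K; ring.
Qed.

End Fixed_length.
End Lipschitz.
End FiniteWalk.

(** * Transport functionals of networks *)

Section ExtendedSums.
Context (R : realType).
Local Open Scope ereal_scope.
Implicit Types (f g : nat -> \bar R).

Lemma nneseries_ge_term f k : (forall i, 0 <= f i) -> f k <= \sum_(i <oo) f i.
Proof.
by move=> f0; rewrite (@nneseriesD1 _ f k)// leeDl// nneseries_ge0.
Qed.

(** For an infinite factor, either all terms vanish or both sides are infinite. *)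
Lemma nneseries_mull (x : \bar R) f : 0 <= x -> (forall i, 0 <= f i) ->
  \sum_(i <oo) (x * f i) = x * \sum_(i <oo) f i.
Proof.
move=> x0 f0; case: x x0 => [r| |] // r0; first by rewrite nneseriesZl.
have [f00|/existsNP[i fi]] := pselect (forall i, f i = 0).
  by rewrite !eseries0 ?mule0// => i _ _; rewrite f00 ?mule0.
have fi0 : 0 < f i by rewrite lt0e f0 andbT; apply/eqP.
rewrite (@gt0_mulye _ (\sum_(i <oo) f i)); last first.
  exact: lt_le_trans (nneseries_ge_term i f0).
apply/eqP; rewrite eq_le leey/=.
have := @nneseries_ge_term (fun i => +oo * f i) i (fun n => mule_ge0 (leey _) (f0 n)).
by rewrite gt0_mulye.
Qed.

Lemma nneseries_mulr (x : \bar R) f : 0 <= x -> (forall i, 0 <= f i) ->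
  \sum_(i <oo) (f i * x) = (\sum_(i <oo) f i) * x.
Proof.
move=> x0 f0; rewrite muleC -nneseries_mull//.
by apply: eq_eseriesr => i _; rewrite muleC.
Qed.

Lemma nneseries_single f k : (forall i, 0 <= f i) -> (forall i, i != k -> f i = 0) ->
  \sum_(i <oo) f i = f k.
Proof.
move=> f0 fk; rewrite (@nneseriesD1 _ f k)//.
rewrite eseries0 ?adde0// => i _ /andP[_ ik]; exact: fk.
Qed.

Lemma nneseries_assoc (A : nat -> \bar R) (B : nat -> nat -> \bar R) (C : nat -> \bar R) :
  (forall i, 0 <= A i) -> (forall i j, 0 <= B i j) -> (forall i, 0 <= C i) ->
  \sum_(z <oo) (A z * \sum_(y <oo) (B z y * C y)) =
  \sum_(y <oo) ((\sum_(z <oo) (A z * B z y)) * C y).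
Proof.
move=> A0 B0 C0.
transitivity (\sum_(z <oo) \sum_(y <oo) (A z * B z y * C y)).
  apply: eq_eseriesr => z _; rewrite -nneseries_mull//.
    by apply: eq_eseriesr => y _; rewrite muleA.
  by move=> y; rewrite mule_ge0.
rewrite nneseries_interchange; last by move=> z y; rewrite !mule_ge0.
by apply: eq_eseriesr => y _; rewrite nneseries_mulr// => z; rewrite mule_ge0.
Qed.

Lemma nneseries_support (D : set nat) f : (forall z, 0 <= f z) ->
  (forall z, ~ D z -> f z = 0) -> \sum_(z <oo) f z = \esum_(z in D) f z.
Proof.
move=> f0 fD; rewrite nneseries_esumT// [RHS]esum_mkcond; apply: eq_esum => z _.
by case: ifPn => // /negP zD; rewrite fD// => Dz; apply: zD; rewrite inE.
Qed.

Lemma nneseries_finite (D : set nat) f : finite_set D ->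
  (forall z, 0 <= f z) -> (forall z, ~ D z -> f z = 0) ->
  \sum_(z <oo) f z = \sum_(z \in D) f z.
Proof. by move=> fD f0 zD; rewrite (nneseries_support f0 zD) esum_fset. Qed.

(* Takes the value [0] at [0] and at [+oo]; the logarithm makes measurability immediate. *)
Definition einv (x : \bar R) : \bar R :=
  if (0 < fine x)%R then (expR (- ln (fine x)))%:E else 0.

Lemma einvE x : 0 <= x -> einv x = ((fine x)^-1)%:E.
Proof.
move=> x0; rewrite /einv; case: ltP => [h|h].
  by rewrite expRN lnK.
by have -> : fine x = 0%R; [apply/eqP; rewrite eq_le h fine_ge0|rewrite invr0].
Qed.

Lemma einv_ge0 x : 0 <= einv x.
Proof. by rewrite /einv; case: ifP => // _; rewrite lee_fin expR_ge0. Qed.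

Lemma measurable_einv : measurable_fun setT einv.
Proof.
apply: measurable_fun_ifT => //.
- by apply: measurable_fun_ltr => //; exact: fine_measurable.
- apply/measurable_EFinP; apply: measurableT_comp => //.
  apply: measurableT_comp => //.
  by apply: measurableT_comp => //; exact: fine_measurable.
Qed.

End ExtendedSums.

(** Choice and pointed structures for the space of networks, on which the sigma-algebra of
    [netspace] is generated. *)
HB.instance Definition _ (R : realType) := gen_eqMixin (network R).
HB.instance Definition _ (R : realType) := gen_choiceMixin (network R).
HB.instance Definition _ (R : realType) := @isPointed.Build (network R)
  (Network (fun _ _ => false) (fun _ _ => 0) (fun _ _ => 0)).

(** * Natural measurable functionals, closed under products and kernel composition *)

Section Functionals.
Context (R : realType).
Local Open Scope ereal_scope.
Implicit Types (N : network R) (F G : network R -> nat -> nat -> \bar R).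

Definition netspace := g_sigma_algebraType (@coord_sets R).

(* Both arguments range over the component of a common root, which, unlike
   [iso_invariant], makes the notion stable under transposition and composition. *)
Definition iso_natural F : Prop := forall N x N' x' phi,
  rooted_iso N x N' x' phi -> forall u v, comp N x u -> comp N x v ->
  F N u v = F N' (phi u) (phi v).

Record transport F : Prop := Transport {
  transport_ge0 : forall N u v, 0 <= F N u v;
  transport_meas : forall u v, measurable_fun setT (fun N : netspace => F N u v);
  transport_iso : iso_natural F }.

Definition local_kernel F : Prop := forall N u v, ~ comp N u v -> F N u v = 0.

Lemma comp_refl N u : comp N u u.
Proof. by exists [::]. Qed.

Lemma comp_trans N u v w : comp N u v -> comp N v w -> comp N u w.
Proof.
move=> [s [us <-]] [t [vt <-]]; exists (s ++ t).
by rewrite cat_path us vt last_cat.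
Qed.

Lemma comp_adj N u v : adj N u v -> comp N u v.
Proof. by move=> uv; exists [:: v]; rewrite /= uv. Qed.

Lemma transport_cst (r : \bar R) : 0 <= r -> transport (fun _ _ _ => r).
Proof. by move=> r0; split. Qed.

Lemma transport_tr F : transport F -> transport (fun N u v => F N v u).
Proof. by move=> [F0 mF iF]; split => // N x N' x' phi i u v ? ?; exact: iF i _ _ _ _. Qed.

Lemma transportM F G : transport F -> transport G ->
  transport (fun N u v => F N u v * G N u v).
Proof.
move=> [F0 mF iF] [G0 mG iG]; split => [N u v|u v|N x N' x' phi i u v xu xv].
- by rewrite mule_ge0.
- exact: emeasurable_funM.
- by rewrite (iF _ _ _ _ _ i)// (iG _ _ _ _ _ i).
Qed.

Lemma transport_map (g : \bar R -> \bar R) F : (forall x, 0 <= x -> 0 <= g x) ->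
  measurable_fun setT g -> transport F -> transport (fun N u v => g (F N u v)).
Proof.
move=> g0 mg [F0 mF iF]; split => [N u v|u v|N x N' x' phi i u v xu xv].
- exact: g0.
- exact: measurableT_comp.
- by rewrite (iF _ _ _ _ _ i).
Qed.

(** An isomorphism is a bijection on the component of the root only. Locality of [F] confines the
    intermediate vertex to that component, so the sum can be reindexed. *)
Lemma transport_comp F G : transport F -> local_kernel F -> transport G ->
  transport (fun N u v => \sum_(z <oo) (F N u z * G N z v)).
Proof.
move=> [F0 mF iF] lF [G0 mG iG]; split => [N u v|u v|N x N' x' phi i u v xu xv].
- by apply: nneseries_ge0 => z _ _; rewrite mule_ge0.
- apply: ge0_emeasurable_sum => [z N _ _|z _]; first by rewrite mule_ge0.
  exact: emeasurable_funM.
- have [phix inj im iso] := i.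
  have x'u : comp N' x' (phi u) by rewrite -im; exists u.
  rewrite (nneseries_support (D := comp N x)).
  + rewrite (nneseries_support (D := comp N' x')).
    * rewrite (reindex_esum (comp N x) (comp N' x') phi).
        by apply: eq_esum => z xz; rewrite (iF _ _ _ _ _ i)// (iG _ _ _ _ _ i).
      split; [by move=> z xz; rewrite /= -im; exists z|by []|].
      by rewrite /set_surj -im.
    * by move=> z; rewrite mule_ge0.
    * by move=> z xz; rewrite lF ?mul0e// => uz; apply: xz; exact: comp_trans uz.
  + by move=> z; rewrite mule_ge0.
  + by move=> z xz; rewrite lF ?mul0e// => uz; apply: xz; exact: comp_trans uz.
Qed.

Lemma local_kernelM F G : local_kernel F -> local_kernel (fun N u v => F N u v * G N u v).
Proof. by move=> lF N u v /lF ->; rewrite mul0e. Qed.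

Lemma local_kernel_comp F G : local_kernel F -> local_kernel G ->
  local_kernel (fun N u v => \sum_(z <oo) (F N u z * G N z v)).
Proof.
move=> lF lG N u v uv; rewrite eseries0// => z _ _.
have [uz|uz] := pselect (comp N u z); last by rewrite lF ?mul0e.
by rewrite (lG _ z v) ?mule0// => zv; apply: uv; exact: comp_trans zv.
Qed.

(* A transport has to be nonnegative, measurable and natural on all networks, not only
   on well-formed ones; the absolute values and the extended sums below ensure it. *)
Definition idE N (u v : nat) : \bar R := if u == v then 1 else 0.
Definition condE N u v : \bar R := if adj N u v then `|cond N u v|%:E else 0.
Definition sqwtE N u v : \bar R := if adj N u v then (wt N u v ^+ 2)%:E else 0.

Lemma transport_eq : transport idE.
Proof.
split => [N u v|u v|N x N' x' phi [_ inj _ _] u v xu xv].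
- by rewrite /idE; case: ifP.
- by rewrite /idE; case: ifP.
- rewrite /idE; have -> // : (phi u == phi v) = (u == v).
  by apply/eqP/eqP => [/inj|->//]; rewrite !inE; apply.
Qed.

Lemma local_eq : local_kernel idE.
Proof.
move=> N u v uv; rewrite /idE; case: eqP => // euv.
by case: uv; rewrite euv; exact: comp_refl.
Qed.

Lemma measurable_adj u v : measurable_fun setT (fun N : netspace => adj N u v).
Proof.
apply: (measurable_fun_bool true); rewrite setTI; apply: sub_sigma_algebra.
by exists u, v; left; exists true.
Qed.

Lemma measurable_cond u v : measurable_fun setT (fun N : netspace => cond N u v).
Proof.
move=> _ B mB; rewrite setTI; apply: sub_sigma_algebra.
by exists u, v; right; exists B; split => //; left.
Qed.

Lemma measurable_wt u v : measurable_fun setT (fun N : netspace => wt N u v).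
Proof.
move=> _ B mB; rewrite setTI; apply: sub_sigma_algebra.
by exists u, v; right; exists B; split => //; right.
Qed.

Lemma transport_cond : transport condE.
Proof.
split => [N u v|u v|N x N' x' phi [_ _ _ iso] u v xu xv].
- by rewrite /condE; case: ifP.
- apply: measurable_fun_ifT => //; first exact: measurable_adj.
  by apply/measurable_EFinP; apply: measurableT_comp => //; exact: measurable_cond.
- rewrite /condE; have [-> ac] := iso _ _ xu xv.
  by case: ifP => // /ac[->].
Qed.

Lemma local_cond : local_kernel condE.
Proof. by move=> N u v uv; rewrite /condE; case: ifP => // /comp_adj. Qed.

Lemma transport_sqwt : transport sqwtE.
Proof.
split => [N u v|u v|N x N' x' phi [_ _ _ iso] u v xu xv].
- by rewrite /sqwtE; case: ifP => // _; rewrite lee_fin sqr_ge0.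
- apply: measurable_fun_ifT => //; first exact: measurable_adj.
  by apply/measurable_EFinP; apply: measurable_funX; exact: measurable_wt.
- rewrite /sqwtE; have [-> ac] := iso _ _ xu xv.
  by case: ifP => // /ac[_ ->].
Qed.

(** The factor [1], here and in [enE], gives the sum the shape of [transport_comp] with a constant
    second functional. *)
Definition degE N u : \bar R := \sum_(z <oo) (condE N u z * 1).
Definition stepE N u v : \bar R := condE N u v * einv (degE N u).
Fixpoint powE s N u v : \bar R :=
  if s is s'.+1 then \sum_(z <oo) (stepE N u z * powE s' N z v) else idE N u v.
Definition enE N u : \bar R := \sum_(z <oo) (stepE N u z * sqwtE N u z * 1).
Definition nz (x : \bar R) : \bar R := if x == 0 then 0 else 1.
(** The volume of the set of vertices that the walk from [u] can occupy at time exactly [s]. *)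
Definition reachE s N u : \bar R := \sum_(z <oo) (nz (powE s N u z) * degE N z).

Lemma transport_deg : transport (fun N u v => degE N u).
Proof. exact: transport_comp transport_cond local_cond (transport_cst _). Qed.

Lemma transport_step : transport stepE.
Proof.
apply: transportM; first exact: transport_cond.
apply: transport_map transport_deg => [x _|]; first exact: einv_ge0.
exact: measurable_einv.
Qed.

Lemma local_step : local_kernel stepE.
Proof. exact: local_kernelM local_cond. Qed.

Lemma local_pow s : local_kernel (powE s).
Proof.
elim: s => [|s IH]; first exact: local_eq.
exact: local_kernel_comp local_step IH.
Qed.

Lemma transport_pow s : transport (powE s).
Proof.
elim: s => [|s IH]; first exact: transport_eq.
exact: transport_comp transport_step local_step IH.
Qed.

Lemma transport_en : transport (fun N u v => enE N u).
Proof.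
apply: (transport_comp (F := fun N u z => stepE N u z * sqwtE N u z)).
- exact: transportM transport_step transport_sqwt.
- exact: local_kernelM local_step.
- exact: transport_cst.
Qed.

Lemma measurable_nz : measurable_fun setT nz.
Proof.
apply: measurable_fun_ifT => //; apply: (measurable_fun_bool true).
rewrite setTI [X in measurable X](_ : _ = [set 0]); first exact: emeasurable_set1.
by apply/seteqP; split => x /=; [move=> /eqP|move=> ->; rewrite eqxx].
Qed.

Lemma nz_ge0 x : 0 <= nz x.
Proof. by rewrite /nz; case: ifP. Qed.

Lemma transport_reach s : transport (fun N u v => reachE s N u).
Proof.
apply: (transport_comp (F := fun N u z => nz (powE s N u z))).
- by apply: transport_map (transport_pow s) => [x _|]; [exact: nz_ge0|exact: measurable_nz].
- by move=> N u v uv; rewrite (local_pow _ uv) /nz eqxx.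
- exact: transport_deg.
Qed.

Lemma powSr s N u v : powE s.+1 N u v = \sum_(z <oo) (powE s N u z * stepE N z v).
Proof.
have p0 := transport_ge0 transport_step N; have q0 s' := transport_ge0 (transport_pow s') N.
elim: s u => [|s IH] u.
  rewrite /= (@nneseries_single _ _ v).
  - rewrite (@nneseries_single _ _ u).
    + by rewrite /idE !eqxx mul1e mule1.
    + by move=> i; rewrite mule_ge0// (transport_ge0 transport_eq).
    + by move=> i iu; rewrite /idE eq_sym (negbTE iu) mul0e.
  - by move=> i; rewrite mule_ge0// (transport_ge0 transport_eq).
  - by move=> i iu; rewrite /idE (negbTE iu) mule0.
transitivity (\sum_(z <oo) (stepE N u z * \sum_(y <oo) (powE s N z y * stepE N y v))).
  by apply: eq_eseriesr => z _; rewrite -IH.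
by rewrite nneseries_assoc.
Qed.

End Functionals.

(** * Mass transport *)

Section WellFormed.
Context (R : realType).
Local Open Scope ereal_scope.
Variables (N : network R) (rho : nat).
Hypothesis wfN : wf_network N rho.

Let fin_nbrs u : comp N rho u -> finite_set (nbrs N u).
Proof. by move=> /wfN[]. Qed.

Let comp_step u v : comp N rho u -> adj N u v -> comp N rho v.
Proof. by move=> ru uv; apply: comp_trans ru _; exact: comp_adj. Qed.

Lemma condE_wf u v : comp N rho u -> adj N u v -> condE N u v = (cond N u v)%:E.
Proof.
move=> /wfN[_ wu] uv; have [_ _ c0 _ _] := wu v uv.
by rewrite /condE uv ger0_norm.
Qed.

Lemma degE_wf u : comp N rho u -> degE N u = (cdeg N u)%:E.
Proof.
move=> ru; rewrite /degE (nneseries_finite (fin_nbrs ru)).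
- rewrite -fsumEFin; last exact: fin_nbrs.
  by apply: eq_fsbigr => v; rewrite inE => uv; rewrite mule1 condE_wf.
- by move=> z; rewrite mule1 (transport_ge0 (@transport_cond R)).
- by move=> z uz; rewrite /condE; case: ifP => [/uz//|_]; rewrite mul0e.
Qed.

Lemma cdeg_ge0 u : comp N rho u -> (0 <= cdeg N u)%R.
Proof.
move=> ru; rewrite -lee_fin -degE_wf//; exact: (transport_ge0 (@transport_deg R) N u u).
Qed.

Lemma cond_le_cdeg u v : comp N rho u -> adj N u v -> (cond N u v <= cdeg N u)%R.
Proof.
move=> ru uv; rewrite -lee_fin -degE_wf// -condE_wf//.
rewrite -[leLHS]mule1; apply: (@nneseries_ge_term _ (fun z => condE N u z * 1)) => i.
by rewrite mule1 (transport_ge0 (@transport_cond R)).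
Qed.

Lemma stepE_wf u v : comp N rho u -> stepE N u v = (step N u v)%:E.
Proof.
move=> ru; rewrite /stepE einvE; last exact: (transport_ge0 (@transport_deg R) N u u).
rewrite degE_wf//= /step; case: ifPn => uv; first by rewrite condE_wf.
by rewrite /condE (negbTE uv) mul0e.
Qed.

Lemma step_ge0 u v : comp N rho u -> (0 <= step N u v)%R.
Proof. by move=> ru; rewrite -lee_fin -stepE_wf// (transport_ge0 (@transport_step R)). Qed.

Lemma stepE_off u v : ~ adj N u v -> stepE N u v = 0.
Proof. by rewrite /stepE /condE; case: ifP => // _ _; rewrite mul0e. Qed.

Lemma nneseries_step u (F : nat -> \bar R) : comp N rho u -> (forall z, 0 <= F z) ->
  \sum_(z <oo) (stepE N u z * F z) =
  \sum_(z \in nbrs N u) ((step N u z)%:E * F z).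
Proof.
move=> ru F0; rewrite (nneseries_finite (fin_nbrs ru)).
- by apply: eq_fsbigr => z _; rewrite stepE_wf.
- by move=> z; rewrite mule_ge0// (transport_ge0 (@transport_step R)).
- by move=> z uz; rewrite stepE_off ?mul0e.
Qed.

Lemma enE_wf u : comp N rho u ->
  enE N u = (\sum_(y \in nbrs N u) step N u y * wt N u y ^+ 2)%R%:E.
Proof.
move=> ru; rewrite /enE.
under eq_eseriesr do rewrite mule1.
rewrite nneseries_step//; last by move=> z; exact: (transport_ge0 (@transport_sqwt R)).
rewrite -fsumEFin; last exact: fin_nbrs.
apply: eq_fsbigr => y; rewrite inE => uy; rewrite EFinM.
by rewrite /sqwtE uy.
Qed.

Lemma stepE_sum u : comp N rho u -> \sum_(z <oo) stepE N u z <= 1.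
Proof.
move=> ru; rewrite /stepE.
have -> : \sum_(z <oo) (condE N u z * einv (degE N u)) = degE N u * einv (degE N u).
  rewrite nneseries_mulr ?einv_ge0//; last by move=> z; exact: (transport_ge0 (@transport_cond R)).
  by rewrite /degE; congr (_ * _); apply: eq_eseriesr => z _; rewrite mule1.
rewrite einvE; last exact: (transport_ge0 (@transport_deg R) N u u).
rewrite degE_wf// -EFinM lee_fin /=.
have [->|c0] := eqVneq (cdeg N u) 0%R; first by rewrite mul0r.
by rewrite divff.
Qed.

Lemma powE_sum s u : comp N rho u -> \sum_(z <oo) powE s N u z <= 1.
Proof.
have q0 s' := transport_ge0 (@transport_pow R s') N.
have p0 := transport_ge0 (@transport_step R) N.
elim: s u => [|s IH] u ru.
  rewrite (@nneseries_single _ (powE 0 N u) u); [by rewrite /= /idE eqxx|exact: q0|].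
  by move=> i iu; rewrite /= /idE eq_sym (negbTE iu).
rewrite /= nneseries_interchange; last by move=> i j; rewrite mule_ge0.
apply: le_trans (stepE_sum ru).
apply: lee_nneseries => [z _ _|z _]; first by apply: nneseries_ge0 => *; rewrite mule_ge0.
rewrite nneseries_mull//.
have [uz|uz] := boolP (adj N u z); last by rewrite stepE_off ?mul0e//; exact/negP.
by rewrite -[leRHS]mule1 lee_wpmul2l// IH//; exact: comp_step uz.
Qed.

Lemma powE_le1 s u v : comp N rho u -> powE s N u v <= 1.
Proof.
move=> ru; apply: le_trans (powE_sum s ru).
by apply: nneseries_ge_term => i; exact: (transport_ge0 (@transport_pow R s)).
Qed.

Lemma powE_fin s u v : comp N rho u -> powE s N u v \is a fin_num.
Proof.
move=> ru; rewrite ge0_fin_numE; last exact: (transport_ge0 (@transport_pow R s)).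
by rewrite (le_lt_trans (powE_le1 s v ru))// ltry.
Qed.

Lemma adj_sym u v : comp N rho u -> comp N rho v -> adj N u v = adj N v u.
Proof.
move=> ru rv; apply/idP/idP => [uv|vu].
  by have [_ /(_ v uv)[]] := wfN ru.
by have [_ /(_ u vu)[]] := wfN rv.
Qed.

Lemma detailed_balance u v : comp N rho u -> adj N u v ->
  (cdeg N u * step N u v = cond N u v)%R.
Proof.
move=> ru uv; rewrite /step uv.
(* At a vertex of degree zero the quotient in [step] defaults to 0, but the conductance, squeezed
   between 0 and the degree, vanishes too. *)
have [c0|c0] := eqVneq (cdeg N u) 0%R; last by rewrite mulrC divfK.
have [_ /(_ v uv)[_ _ cuv _ _]] := wfN ru.
have := cond_le_cdeg ru uv; rewrite c0 mul0r => h.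
by apply/eqP; rewrite eq_le h cuv.
Qed.

Lemma step_rev u v : comp N rho u -> comp N rho v ->
  (cdeg N u * step N u v = cdeg N v * step N v u)%R.
Proof.
move=> ru rv; have [uv|uv] := boolP (adj N u v).
  rewrite (detailed_balance ru uv) (detailed_balance rv); last by rewrite -(adj_sym ru rv).
  by have [_ /(_ v uv)[]] := wfN ru.
by rewrite /step -(adj_sym ru rv) (negbTE uv) !mulr0.
Qed.

(** By induction, splitting off the first step on one side and the last on the other ([powSr]);
    [step_rev] reverses that step. *)
Lemma powE_rev s u v : comp N rho u -> comp N rho v ->
  degE N u * powE s N u v = degE N v * powE s N v u.
Proof.
have d0 w := transport_ge0 (@transport_deg R) N w w.
have q0 s' := transport_ge0 (@transport_pow R s') N.
have p0 := transport_ge0 (@transport_step R) N.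
elim: s u v => [|s IH] u v ru rv.
  by rewrite /= /idE eq_sym; case: eqP => [->//|_]; rewrite !mule0.
rewrite [in RHS]powSr [powE _ _ u v]/= -!nneseries_mull//; last 2 first.
- by move=> i; rewrite mule_ge0.
- by move=> i; rewrite mule_ge0.
apply: eq_eseriesr => z _; have [rz|rz] := pselect (comp N rho z).
  rewrite muleA stepE_wf// degE_wf// -EFinM step_rev// EFinM -(degE_wf rz) -(stepE_wf _ rz).
  by rewrite -muleA muleCA IH// muleC -muleA.
rewrite stepE_off ?mul0e ?mule0; last by move=> /(comp_step ru).
by rewrite local_pow ?mul0e ?mule0// => vz; apply: rz; exact: comp_trans vz.
Qed.

End WellFormed.

Section MassTransport.
Context (R : realType) (d : measure_display) (Omega : measurableType d)
  (P : probability Omega R) (net : Omega -> network R) (rt : Omega -> nat).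
Hypothesis rnet : random_network net rt.
Hypothesis rev : reversible P net rt.
Local Open Scope ereal_scope.

Lemma rt_wf w : wf_network (net w) (rt w).
Proof. by case: rnet. Qed.

Lemma measurable_net : measurable_fun setT (net : Omega -> netspace R).
Proof.
have [_ madj mcond mwt _] := rnet.
apply: (@measurability _ _ _ (netspace R) setT net (@coord_sets R) erefl)
  => _ [A [u [v [[b ->]|[B [mB [->|->]]]]]] <-];
  rewrite setTI; [exact: madj|exact: mcond|exact: mwt].
Qed.

(** The root takes countably many values, and on each of its level sets the functional has fixed
    arguments. *)
Lemma measurable_rooted F : transport F ->
  measurable_fun setT (fun w => F (net w) (rt w) (rt w)).
Proof.
move=> [_ mF _] _ B mB; rewrite setTI.
have [mrt _ _ _ _] := rnet.
rewrite [X in measurable X](_ : _ = \bigcup_k (rt @^-1` [set k] `&`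
   (fun w => F (net w) k k) @^-1` B)); last first.
  apply/seteqP; split => [w Bw|w [k _ [/= <-]]//].
  by exists (rt w).
apply: bigcup_measurable => k _; apply: measurableI; first exact: mrt.
have mk : measurable_fun setT (fun w => F (net w) k k).
  exact: measurableT_comp (mF k k) measurable_net.
by rewrite -[X in measurable X]setTI; exact: mk.
Qed.

Lemma transport_one_step F : transport F ->
  \int[P]_w (\sum_(y <oo) (stepE (net w) (rt w) y * F (net w) (rt w) y)) =
  \int[P]_w (\sum_(y <oo) (stepE (net w) (rt w) y * F (net w) y (rt w))).
Proof.
move=> [F0 mF iF]; have [_ /(_ F F0) rv] := rev.
have cr w := comp_refl (net w) (rt w).
under eq_integral => w _ do rewrite (nneseries_step (@rt_wf w))//.
under [RHS]eq_integral => w _ do rewrite (nneseries_step (@rt_wf w))//.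
apply: rv.
  by move=> x y B mB; have := mF x y measurableT B mB; rewrite setTI.
by move=> N x y N' x' phi i xy; apply: iF i _ _ _ _ => //; exact: comp_refl.
Qed.

(** Induction on the length of the walk: reversing the first step and then the remaining [s] steps
    exchanges the two ends of the whole walk. *)
Lemma mass_transport s F : transport F ->
  \int[P]_w (\sum_(y <oo) (powE s (net w) (rt w) y * F (net w) (rt w) y)) =
  \int[P]_w (\sum_(y <oo) (powE s (net w) (rt w) y * F (net w) y (rt w))).
Proof.
have p0 := transport_ge0 (@transport_step R).
have q0 s' := transport_ge0 (@transport_pow R s').
elim: s F => [|s IH] F tF; have F0 := transport_ge0 tF.
  have single w (G : nat -> \bar R) : (forall y, 0 <= G y) ->
      \sum_(y <oo) (powE 0 (net w) (rt w) y * G y) = G (rt w).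
    move=> G0; rewrite (@nneseries_single _ (fun y => powE 0 (net w) (rt w) y * G y) (rt w)).
    - by rewrite /= /idE eqxx mul1e.
    - by move=> i; rewrite mule_ge0.
    - by move=> i iu; rewrite /= /idE eq_sym (negbTE iu) mul0e.
  by apply: eq_integral => w _; rewrite !single.
(* [H] averages over the last [s] steps with the starting point kept fixed, so that only the first
   step is left to reverse. *)
pose H N x z := \sum_(y <oo) (powE s N z y * F N x y).
have tH : transport H.
  apply: (transport_tr (F := fun N z x => \sum_(y <oo) (powE s N z y * F N x y))).
  exact: transport_comp (@transport_pow R s) (@local_pow R s) (transport_tr tF).
(* Once the first step is reversed, [K] absorbs it, and the induction hypothesis applies to [K]. *)
pose K N x y := \sum_(z <oo) (stepE N x z * F N z y).
have tK : transport K by exact: transport_comp (@transport_step R) (@local_step R) tF.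
transitivity (\int[P]_w (\sum_(z <oo) (stepE (net w) (rt w) z * H (net w) (rt w) z))).
  by apply: eq_integral => w _; rewrite /H nneseries_assoc.
rewrite transport_one_step//.
transitivity (\int[P]_w (\sum_(y <oo) (powE s (net w) (rt w) y * K (net w) (rt w) y))).
  apply: eq_integral => w _; rewrite /H /K.
  transitivity (\sum_(z <oo) \sum_(y <oo)
      (stepE (net w) (rt w) z * (powE s (net w) (rt w) y * F (net w) z y))).
    by apply: eq_eseriesr => z _; rewrite nneseries_mull// => y; rewrite mule_ge0.
  rewrite nneseries_interchange; last by move=> i j; apply: mule_ge0 => //; exact: mule_ge0.
  apply: eq_eseriesr => y _; rewrite -nneseries_mull//; last by move=> z; rewrite mule_ge0.
  by apply: eq_eseriesr => z _; rewrite muleCA.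
rewrite IH//; apply: eq_integral => w _; rewrite /K nneseries_assoc//.
by apply: eq_eseriesr => y _; rewrite powSr.
Qed.

(** * Mean energy and mean mass along the walk *)

Definition root_energy := \int[P]_w enE (net w) (rt w).

(** Mass transport moves the energy from the endpoint of the walk to its root, where it multiplies a
    total mass of at most one. *)
Lemma energy_stationary s :
  \int[P]_w (\sum_(y <oo) (powE s (net w) (rt w) y * enE (net w) y)) <= root_energy.
Proof.
have e0 N u := transport_ge0 (@transport_en R) N u u.
rewrite (mass_transport s (transport_tr (@transport_en R))).
apply: ge0_le_integral => //.
- move=> w _; apply: nneseries_ge0 => y _ _; rewrite mule_ge0//.
  exact: (transport_ge0 (@transport_pow R s)).
- apply: (measurable_rooted (F := fun N u v => \sum_(y <oo) (powE s N u y * enE N v))).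
  apply: transport_comp (@transport_pow R s) (@local_pow R s) _.
  exact: transport_tr (@transport_en R).
- exact: (measurable_rooted (@transport_en R)).
- move=> w _; rewrite nneseries_mulr//; last first.
    by move=> y; exact: (transport_ge0 (@transport_pow R s)).
  by rewrite -[leRHS]mul1e lee_wpmul2r// (powE_sum (@rt_wf w))//; exact: comp_refl.
Qed.

(* Transported along the [s]-step walk, the factor [1 / powE s] turns the sum over the
   walk into a sum over the set it reaches in [s] steps, by detailed balance. *)
Definition massE s (N : network R) u v : \bar R :=
  degE N v * enE N v * einv (powE s N u v) * einv (reachE s N v).

Lemma transport_mass s : transport (massE s).
Proof.
apply: transportM; first apply: transportM; first apply: transportM.
- exact: transport_tr (@transport_deg R).
- exact: transport_tr (@transport_en R).
- by apply: transport_map (@transport_pow R s) => [x _|]; [exact: einv_ge0|exact: measurable_einv].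
- apply: transport_map (transport_tr (@transport_reach R s)) => [x _|]; first exact: einv_ge0.
  exact: measurable_einv.
Qed.

Lemma mass_stationary s :
  \int[P]_w (\sum_(y <oo) (powE s (net w) (rt w) y * massE s (net w) (rt w) y))
  <= root_energy.
Proof.
have e0 N u := transport_ge0 (@transport_en R) N u u.
have d0 N u := transport_ge0 (@transport_deg R) N u u.
have r0 N u := transport_ge0 (@transport_reach R s) N u u.
have q0 := transport_ge0 (@transport_pow R s).
have m0 := transport_ge0 (@transport_mass s).
rewrite (mass_transport s (@transport_mass s)).
apply: ge0_le_integral => //.
- by move=> w _; apply: nneseries_ge0 => y _ _; rewrite mule_ge0.
- apply: (measurable_rooted (F := fun N u v => \sum_(y <oo) (powE s N u y * massE s N y v))).
  exact: transport_comp (@transport_pow R s) (@local_pow R s) (@transport_mass s).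
- exact: (measurable_rooted (@transport_en R)).
- move=> w _; set N := net w; set rho := rt w.
  have wf := @rt_wf w; have cr := comp_refl N rho.
  (* Detailed balance replaces [degE N rho * powE s N rho y] by [degE N y * powE s N y rho], whose
     second factor cancels against its inverse in [massE]. *)
  apply: (@le_trans _ _ (\sum_(y <oo) (nz (powE s N rho y) * degE N y *
      (enE N rho * einv (reachE s N rho))))).
    apply: lee_nneseries => [y _ _|y _]; first by rewrite mule_ge0.
    have [->|py] := eqVneq (powE s N rho y) 0; first by rewrite /nz eqxx !mul0e.
    rewrite {1}/nz (negbTE py) mul1e /massE !muleA lee_wpmul2r ?einv_ge0//.
    rewrite muleAC lee_wpmul2r//.
    have ry : comp N rho y.
      by apply: contrapT => ry; move: py; rewrite (local_pow _ ry) eqxx.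
    rewrite [powE s N rho y * _]muleC (powE_rev wf)// -muleA einvE//.
    rewrite -[leRHS]mule1 lee_wpmul2l//.
    rewrite -{1}(fineK (powE_fin wf s rho ry)) -EFinM lee_fin.
    have [->|h] := eqVneq (fine (powE s N y rho)) 0%R; first by rewrite mul0r.
    by rewrite divff.
  rewrite nneseries_mulr ?mule_ge0 ?einv_ge0//; last by move=> y; rewrite mule_ge0// nz_ge0.
  rewrite -/(reachE s N rho) muleCA -[leRHS]mule1 lee_wpmul2l//.
  (* The product of [reachE] and its [einv] is 1, or 0 when [reachE] is 0 or infinite; it is at most
     one in every case. *)
  rewrite einvE//; have := r0 N rho; case: (reachE s N rho) => [r| |] //= r_ge0.
    rewrite -EFinM lee_fin; have [->|h] := eqVneq r 0%R; first by rewrite mul0r.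
    by rewrite divff.
  by rewrite invr0 mule0.
Qed.

(** By Tonelli the weighted sum has finite expectation, hence is almost surely finite. This turns
    bounds on means, uniform in [s], into almost sure growth bounds. *)
Lemma weighted_ae_finite (g : nat -> Omega -> \bar R) (a : nat -> R) :
  (forall s w, 0 <= g s w) -> (forall s, measurable_fun setT (g s)) ->
  (forall s, \int[P]_w g s w <= root_energy) -> root_energy < +oo ->
  (forall s, (0 <= a s)%R) -> \sum_(s <oo) (a s)%:E < +oo ->
  {ae P, forall w, \sum_(s <oo) ((a s)%:E * g s w) < +oo}.
Proof.
move=> g0 mg gE Efin a0 afin.
pose G w := \sum_(s <oo) ((a s)%:E * g s w).
have G0 w : 0 <= G w by apply: nneseries_ge0 => s _ _; rewrite mule_ge0// lee_fin.
have mag s : measurable_fun setT (fun w => (a s)%:E * g s w).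
  by apply: emeasurable_funM => //; exact: mg.
have mG : measurable_fun setT G.
  by apply: ge0_emeasurable_sum => // s w _ _; rewrite mule_ge0// lee_fin.
have E0 : 0 <= root_energy.
  by apply: integral_ge0 => w _; exact: (transport_ge0 (@transport_en R) _ _ (rt w)).
have iG : P.-integrable setT G.
  apply/integrableP; split => //.
  under eq_integral do rewrite gee0_abs//.
  rewrite integral_nneseries//; last by move=> s w _; rewrite mule_ge0// lee_fin.
  apply: (@le_lt_trans _ _ (\sum_(s <oo) ((a s)%:E * root_energy))).
    apply: lee_nneseries => [s _ _|s _].
      by apply: integral_ge0 => w _; rewrite mule_ge0// lee_fin.
    rewrite ge0_integralZl//; last by rewrite lee_fin.
    by rewrite lee_wpmul2l ?lee_fin.
  rewrite nneseries_mulr//.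
  have A0 : 0 <= \sum_(s <oo) (a s)%:E by apply: nneseries_ge0 => s _ _; rewrite lee_fin.
  by apply: lte_mul_pinfty => //; rewrite ge0_fin_numE.
have := integrable_ae measurableT iG.
apply: filterS => w /(_ I); rewrite ge0_fin_numE//.
Qed.

End MassTransport.

(** * The quenched bound on a network *)

Section Geometry.
Context (R : realType).
Variables (N : network R) (rho : nat).
Hypothesis wfN : wf_network N rho.

Lemma pathwt_rcons x s y : pathwt N x (rcons s y) = pathwt N x s + wt N (last x s) y.
Proof. by elim: s x => [|z s IH] x /=; rewrite ?addr0 ?add0r// IH addrA. Qed.

Lemma pathwt_ge0 x s : comp N rho x -> path (adj N) x s -> 0 <= pathwt N x s.
Proof.
elim: s x => [//|y s IH] x rx /= /andP[xy ys].
have [_ /(_ y xy)[_ _ _ _ w0]] := wfN rx.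
by rewrite addr_ge0// IH//; apply: comp_trans rx _; exact: comp_adj.
Qed.

Lemma wdist_le y s : path (adj N) rho s -> last rho s = y ->
  wdist N rho y <= pathwt N rho s.
Proof.
move=> ps ls; apply: ge_inf; last by exists s.
exists 0 => _ [t [pt _ ->]]; apply: pathwt_ge0 pt; exact: comp_refl.
Qed.

Lemma le_wdist y (a : R) : comp N rho y ->
  (forall s, path (adj N) rho s -> last rho s = y -> a <= pathwt N rho s) ->
  a <= wdist N rho y.
Proof.
move=> [s [ps ls]] H; apply: lb_le_inf; first by exists (pathwt N rho s), s.
by move=> _ [t [pt lt ->]]; exact: H.
Qed.

Lemma wdist_ge0 y : comp N rho y -> 0 <= wdist N rho y.
Proof. by move=> ry; apply: le_wdist => // s ps _; apply: pathwt_ge0 ps; exact: comp_refl. Qed.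

Lemma wdist_root : wdist N rho rho = 0.
Proof.
apply/eqP; rewrite eq_le wdist_ge0 ?andbT; last exact: comp_refl.
exact: (@wdist_le rho [::]).
Qed.

Lemma wdist_adj x y : comp N rho x -> adj N x y ->
  wdist N rho y <= wdist N rho x + wt N x y.
Proof.
move=> rx xy; rewrite -lerBlDr; apply: le_wdist => // s ps ls.
rewrite lerBlDr; have := @wdist_le y (rcons s y).
by rewrite pathwt_rcons ls; apply; rewrite ?last_rcons// rcons_path ps ls.
Qed.

Lemma wdist_lipschitz x y : comp N rho x -> adj N x y ->
  (wdist N rho y - wdist N rho x) ^+ 2 <= wt N x y ^+ 2.
Proof.
move=> rx xy; have ry : comp N rho y by apply: comp_trans rx _; exact: comp_adj.
have [_ /(_ y xy)[yx _ _ wxy w0]] := wfN rx.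
have := wdist_adj rx xy; have := wdist_adj ry yx; rewrite -wxy => h1 h2.
set D := _ - _; have hm : 0 <= (wt N x y - D) * (wt N x y + D).
  by apply: mulr_ge0; rewrite /D; lra.
by lra.
Qed.

Lemma gball_le x r r' : (r <= r')%N -> gball N x r `<=` gball N x r'.
Proof. by move=> rr' y [s [ps ls sr]]; exists s; split => //; exact: leq_trans rr'. Qed.

Lemma gball_trans x y z r r' : gball N x r y -> gball N y r' z -> gball N x (r + r') z.
Proof.
move=> [s [ps ls sr]] [t [pt lt tr]]; exists (s ++ t).
by rewrite cat_path ps ls pt last_cat ls lt size_cat leq_add.
Qed.

Lemma gball_comp x r : gball N x r `<=` comp N x.
Proof. by move=> y [s [ps ls _]]; exists s. Qed.

Lemma gball_finite x r : comp N rho x -> finite_set (gball N x r).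
Proof.
elim: r x => [|r IH] x rx.
  apply: (@sub_finite_set _ _ [set x]) => //.
  by move=> y [s [_ <-]]; rewrite leqn0 => /nilP ->.
apply: (@sub_finite_set _ _ ([set x] `|` \bigcup_(z in nbrs N x) gball N z r)).
  move=> y [[|z s] [/= ps ls sr]]; first by left.
  by right; case/andP: ps => xz zs; exists z => //; exists s.
rewrite finite_setU; split => //; apply: bigcup_finite; first by have [] := wfN rx.
by move=> z xz; apply: IH; apply: comp_trans rx _; exact: comp_adj.
Qed.

Lemma powE_gball s u v : powE s N u v != 0%E -> gball N u s v.
Proof.
elim: s u => [|s IH] u /=.
  by rewrite /idE; case: (u =P v) => [-> _|]; [exists [::]|rewrite eqxx].
have [H|/existsNP[z /eqP zH]] := pselect (forall z, (stepE N u z * powE s N z v = 0)%E).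
  by rewrite eseries0 ?eqxx// => z _ _; rewrite H.
move=> _; have [uz|uz] := boolP (adj N u z); last first.
  by move: zH; rewrite stepE_off ?mul0e ?eqxx//; exact/negP.
have [t [pt lt ts]] : gball N z s v.
  by apply: IH; apply: contraNneq zH => ->; rewrite mule0.
by exists (z :: t); rewrite /= uz.
Qed.

Lemma vol_le r r' : (r <= r')%N -> vol N rho r <= vol N rho r'.
Proof.
move=> rr'; rewrite /vol !fsbig_finite//; try exact: gball_finite (comp_refl _ _).
rewrite [leRHS](big_fsetID _ (mem (gball N rho r)))/=.
rewrite [X in _ <= X + _](_ : _ = \sum_(y <- fset_set (gball N rho r)) cdeg N y).
  rewrite lerDl big_seq sumr_ge0// => y; rewrite !inE/= => /andP[+ _].
  rewrite in_fset_set; last exact: gball_finite (comp_refl _ _).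
  by rewrite inE => /gball_comp; exact: cdeg_ge0.
apply: eq_fbigl => y; rewrite !inE/= !in_fset_set; try exact: gball_finite (comp_refl _ _).
by apply/andP/idP => [[]//|h]; split => //; rewrite inE; apply: gball_le rr' _ _; rewrite inE in h.
Qed.

End Geometry.

(** * Restriction to the vertices reached within [n] steps *)

Section QuenchedBound.
Context (R : realType).
Variables (N : network R) (rho : nat).
Hypothesis wfN : wf_network N rho.
Variable n : nat.

(** Edges may have zero conductance, so this can be smaller than the ball. Positivity of [powE] is
    what lets its inverse in [massE] be cancelled. *)
Definition reached : set nat := [set x | exists2 s, (s <= n)%N & powE s N rho x != 0%E].

Lemma reached_comp : reached `<=` comp N rho.
Proof. by move=> x [s _ /powE_gball /gball_comp]. Qed.

Lemma reached_finite : finite_set reached.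
Proof.
apply: sub_finite_set (gball_finite wfN n (comp_refl N rho)) => x [s sn /powE_gball].
exact: gball_le.
Qed.

Definition reachedV := fset_set reached.

Lemma in_reachedV x : (x \in reachedV) = (x \in reached).
Proof. by rewrite in_fset_set//; exact: reached_finite. Qed.

Lemma reachedVP (x : reachedV) : reached (val x).
Proof. by have := valP x; rewrite in_reachedV inE. Qed.

Lemma val_comp (x : reachedV) : comp N rho (val x).
Proof. exact: reached_comp (reachedVP x). Qed.

Lemma root_in : rho \in reachedV.
Proof. by rewrite in_reachedV inE; exists 0%N => //=; rewrite /idE eqxx. Qed.

Let o : reachedV := [` root_in]%fset.

Let p (x y : reachedV) : R := step N (val x) (val y).

Let c (x : reachedV) : R := cdeg N (val x).

Let f (x : reachedV) : R := wdist N rho (val x).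

Lemma sum_reachedV_le (g : nat -> \bar R) : (forall i, 0 <= g i)%E ->
  (\sum_(x : reachedV) g (val x) <= \sum_(i <oo) g i)%E.
Proof.
move=> g0; rewrite -(big_seq_fsetE _ reachedV predT g)/=.
exact: (lee_sum_fset_lim reachedV predT).
Qed.

Let p_ge0 x y : 0 <= p x y.
Proof. by apply: (step_ge0 wfN); exact: val_comp. Qed.

Let p_le1 x : \sum_y p x y <= 1.
Proof.
rewrite -lee_fin -sumEFin; apply: le_trans (stepE_sum wfN (val_comp x)).
under eq_bigr do rewrite -(stepE_wf wfN _ (val_comp x)).
by apply: (sum_reachedV_le (g := stepE N (val x))) => i; exact: (transport_ge0 (@transport_step R)).
Qed.

Let c_ge0 x : 0 <= c x.
Proof. by apply: (cdeg_ge0 wfN); exact: val_comp. Qed.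

Let p_rev x y : c x * p x y = c y * p y x.
Proof. by apply: (step_rev wfN); exact: val_comp. Qed.

Lemma powE_step s x y : powE s N rho x != 0%E -> step N x y != 0 ->
  powE s.+1 N rho y != 0%E.
Proof.
move=> px pxy; have rx : comp N rho x by apply: gball_comp; exact: powE_gball px.
have q0 := transport_ge0 (@transport_pow R s) N.
have p0 := transport_ge0 (@transport_step R) N.
apply/eqP => h.
have : (powE s N rho x * stepE N x y <= powE s.+1 N rho y)%E.
  rewrite powSr; apply: (@nneseries_ge_term _ (fun z => powE s N rho z * stepE N z y)%E) => i.
  by rewrite mule_ge0.
rewrite h (stepE_wf wfN _ rx) => le0.
have : (powE s N rho x * (step N x y)%:E == 0)%E.
  by rewrite eq_le le0 mule_ge0// lee_fin (step_ge0 wfN).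
by rewrite mule_eq0 (negbTE px) eqe (negbTE pxy).
Qed.

(** Restriction to [reached] loses nothing: a vertex occupied with positive probability at time [s]
    has only successors of the same kind at time [s + 1], and the invariant [s + m <= n] keeps the
    clock within range. *)
Lemma walkE_pathE m s (x : reachedV) (F : seq nat -> R) : (s + m <= n)%N ->
  powE s N rho (val x) != 0%E ->
  walkE N m (val x) F = pathE p m x (fun t => F (map val t)).
Proof.
elim: m s x F => [//|m IH] s x F sm px /=.
pose g y := step N (val x) y * walkE N m y (fun t => F (val x :: t)).
have fin : finite_set (nbrs N (val x)) by have [] := wfN (val_comp x).
have in_r y : step N (val x) y != 0 -> reached y.
  move=> h; exists s.+1; last exact: powE_step px h.
  by apply: leq_trans sm; rewrite addnS ltnS leq_addr.
transitivity (\sum_(y \in nbrs N (val x) `|` reached) g y).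
  apply: fsbig_widen; first by move=> y; left.
  move=> y [_ /= ny]; rewrite /g /step; case: ifP => [|_]; last by rewrite mul0r.
  by move=> h; exfalso; exact: ny.
transitivity (\sum_(y \in reached) g y).
  apply/esym; apply: fsbig_widen; first by move=> y; right.
  move=> y [_ /= ny]; rewrite /g.
  have [->|h] := eqVneq (step N (val x) y) 0; first by rewrite mul0r.
  by exfalso; apply: ny; exact: in_r.
rewrite fsbig_finite; last exact: reached_finite.
rewrite big_seq_fsetE/=; apply: eq_bigr => y _.
rewrite /g -/(p x y); have [->|h] := eqVneq (p x y) 0; first by rewrite !mul0r.
congr (_ * _); apply: (IH s.+1); first by rewrite addSn -addnS.
exact: powE_step px h.
Qed.

Lemma energy_le (x : reachedV) : ((energy p f x)%:E <= enE N (val x))%E.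
Proof.
have p0 := transport_ge0 (@transport_step R) N.
have w0 := transport_ge0 (@transport_sqwt R) N.
apply: (@le_trans _ _ (\sum_(y : reachedV)
    (stepE N (val x) (val y) * sqwtE N (val x) (val y) * 1)%E)); last first.
  apply: (sum_reachedV_le (g := fun y => (stepE N (val x) y * sqwtE N (val x) y * 1)%E)) => i.
  by rewrite mule1 mule_ge0.
rewrite /energy -sumEFin; apply: lee_sum => y _.
rewrite mule1 (stepE_wf wfN _ (val_comp x)) /p EFinM.
have [xy|xy] := boolP (adj N (val x) (val y)); last by rewrite /step (negbTE xy) !mul0e.
rewrite lee_wpmul2l ?lee_fin//; first exact: p_ge0.
rewrite /sqwtE xy lee_fin; exact: (wdist_lipschitz wfN (val_comp x) xy).
Qed.

Lemma iter_energy_le i (x : reachedV) :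
  ((iter i (avg p) (energy p f) x)%:E <=
   \sum_(y <oo) (powE i N (val x) y * enE N y))%E.
Proof.
have p0 := transport_ge0 (@transport_step R) N.
have q0 s := transport_ge0 (@transport_pow R s) N.
have e0 u := transport_ge0 (@transport_en R) N u u.
elim: i x => [|i IH] x /=.
  apply: (le_trans (energy_le x)).
  apply: le_trans (@nneseries_ge_term _ (fun y => powE 0 N (val x) y * enE N y)%E (val x) _).
    by rewrite /= /idE eqxx mul1e.
  by move=> y; rewrite mule_ge0.
rewrite -nneseries_assoc// /avg -sumEFin.
apply: le_trans (sum_reachedV_le (g := fun z =>
  (stepE N (val x) z * \sum_(y <oo) (powE i N z y * enE N y))%E) _).
  apply: lee_sum => z _; rewrite EFinM -(stepE_wf wfN _ (val_comp x)).
  by rewrite lee_wpmul2l.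
move=> z; apply: mule_ge0 => //; apply: nneseries_ge0 => y _ _; exact: mule_ge0.
Qed.

Definition mean_energy i : \bar R := (\sum_(y <oo) (powE i N rho y * enE N y))%E.

Definition reached_mass i : \bar R :=
  (\sum_(y <oo) (nz (powE i N rho y) * (degE N y * enE N y)))%E.

Lemma energy_sum_le : ((energy_sum p f o n)%:E <= \sum_(i < n.+1) mean_energy i)%E.
Proof. by rewrite /energy_sum -sumEFin; apply: lee_sum => i _; exact: (iter_energy_le i o). Qed.

(** Every vertex of [reached] lies in the support of the walk at some time [i <= n]; vertices met at
    several times are merely overcounted. *)
Lemma energy_mass_le : ((energy_mass p c f)%:E <= \sum_(i < n.+1) reached_mass i)%E.
Proof.
have d0 u := transport_ge0 (@transport_deg R) N u u.
have e0 u := transport_ge0 (@transport_en R) N u u.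
have t0 i y : (0 <= nz (powE i N rho y) * (degE N y * enE N y))%E.
  by apply: mule_ge0; [exact: nz_ge0|exact: mule_ge0].
pose g y := (\sum_(i < n.+1) nz (powE i N rho y) * (degE N y * enE N y))%E.
have -> : (\sum_(i < n.+1) reached_mass i = \sum_(y <oo) g y)%E.
  have := @nneseries_sum_nat R 0 n.+1
    (fun i y => nz (powE i N rho y) * (degE N y * enE N y))%E 0 t0.
  by rewrite big_mkord => <-; apply: eq_eseriesr => y _; rewrite big_mkord.
have g0 y : (0 <= g y)%E by apply: sume_ge0.
apply: le_trans (sum_reachedV_le g0).
rewrite /energy_mass -sumEFin; apply: lee_sum => x _.
apply: (@le_trans _ _ (degE N (val x) * enE N (val x))%E).
  rewrite EFinM -(degE_wf wfN (val_comp x)) lee_wpmul2l//; exact: energy_le.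
have [s sn ps] := reachedVP x.
have sn1 : (s < n.+1)%N by rewrite ltnS.
rewrite /g (bigD1 (Ordinal sn1))//= {1}/nz (negbTE ps) mul1e leeDl// sume_ge0//.
Qed.

Lemma quenched_bound (L H M : R) : 0 < cdeg N rho -> (0 < n)%N -> 0 < L ->
  (\sum_(i < n.+1) mean_energy i <= H%:E)%E ->
  (\sum_(i < n.+1) reached_mass i <= M%:E)%E ->
  walkE N n rho (fun s => \big[Num.max/0]_(x <- s) wdist N rho x ^+ 2) <=
  1 + 3 * L * H + n%:R ^+ 4 * (16 * expR (1 - L / 32)) * (H + M / cdeg N rho).
Proof.
move=> co n0 L0 HH MM.
have -> : walkE N n rho (fun s => \big[Num.max/0]_(x <- s) wdist N rho x ^+ 2) =
    pathE p n o (fun s => \big[Num.max/0]_(x <- s) f x ^+ 2).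
  rewrite -[in LHS]/(val o) (@walkE_pathE n 0 o)//; last by rewrite /= /idE eqxx.
  by apply: eq_pathE => // t _; rewrite big_map.
have fo : f o = 0 by exact: (wdist_root wfN).
have f_ge0 x : 0 <= f x by apply: (wdist_ge0 wfN); exact: val_comp.
apply: (le_trans (max_displacement p_ge0 p_le1 c_ge0 p_rev f_ge0 fo co n0 L0)).
have h1 : energy_sum p f o n <= H by rewrite -lee_fin; apply: le_trans HH; exact: energy_sum_le.
have h2 : energy_mass p c f <= M by rewrite -lee_fin; apply: le_trans MM; exact: energy_mass_le.
apply: lerD; first by rewrite lerD2l ler_wpM2l// mulr_ge0// ltW.
apply: ler_wpM2l; first by rewrite !mulr_ge0 ?exprn_ge0 ?expR_ge0.
by apply: lerD => //; rewrite ler_pM2r ?invr_gt0.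
Qed.

End QuenchedBound.

(** * Growth rates *)

Section Weights.
Context (R : realType).
Variable e : R.
Hypothesis e0 : 0 < e.

Definition weight s : R := (s.+2%:R `^ (1 + e))^-1.

Lemma weight_ge0 s : 0 <= weight s.
Proof. by rewrite invr_ge0 powR_ge0. Qed.

(** With [m = s + 2], the inequality [ln ((m - 1) / m) <= - 1 / m] gives
    [(m / (m - 1))^e >= 1 + e / m]. The shift by 2 in [weight] keeps [m - 1] positive. *)
Lemma weight_telescope s :
  e * weight s <= (s.+1%:R `^ e)^-1 - (s.+2%:R `^ e)^-1.
Proof.
pose m : R := s.+2%:R.
have m0 : 0 < m by rewrite ltr0n.
have m1 : 0 < m - 1 by rewrite /m -natr1 addrK ltr0n.
have -> : s.+1%:R = m - 1 :> R by rewrite /m -[in RHS]natr1 addrK.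
have -> : weight s = (m `^ e)^-1 * m^-1.
  by rewrite /weight powRD ?powRr1 ?invfM 1?mulrC// ?ltW//; apply/implyP; rewrite (gt_eqF m0).
rewrite -/m; clearbody m.
have pm : 0 < m `^ e by rewrite powR_gt0.
have pm1 : 0 < (m - 1) `^ e by rewrite powR_gt0.
have key : 1 + e / m <= m `^ e / (m - 1) `^ e.
  rewrite /powR !gt_eqF// -expRN -expRD -mulrN -mulrDr.
  apply: le_trans (expR_ge1Dx _); rewrite lerD2l ler_wpM2l ?(ltW e0)//.
  have h : ln ((m - 1) / m) <= (m - 1) / m - 1.
    have := @le_ln1Dx R ((m - 1) / m - 1).
    rewrite [1 + _]addrC subrK; apply.
    by rewrite ltrBrDl subrr divr_gt0.
  have e1 : (m - 1) / m - 1 = - m^-1 by field; rewrite gt_eqF.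
  move: h; rewrite e1 lnM ?posrE ?invr_gt0// lnV ?posrE//; lra.
have : (m `^ e)^-1 * (1 + e / m) <= (m `^ e)^-1 * (m `^ e / (m - 1) `^ e).
  by rewrite ler_wpM2l// invr_ge0 ltW.
rewrite [X in _ <= X]mulrA mulVf ?gt_eqF// mul1r mulrDr mulr1.
have -> : (m `^ e)^-1 * (e / m) = e * ((m `^ e)^-1 * m^-1) by ring.
lra.
Qed.

Lemma weight_summable : (\sum_(s <oo) (weight s)%:E < +oo)%E.
Proof.
apply: (@le_lt_trans _ _ (e^-1)%:E); last exact: ltry.
apply: lime_le; first by apply: is_cvg_nneseries => s _ _; rewrite lee_fin weight_ge0.
apply: nearW => n; rewrite big_mkord sumEFin lee_fin.
rewrite -[leRHS]mul1r ler_pdivlMr// mulr_suml.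
suff : \sum_(s < n) weight s * e <= 1 - (n.+1%:R `^ e)^-1.
  by move/le_trans; apply; rewrite lerBlDl lerDr invr_ge0 powR_ge0.
elim: n => [|n IH]; first by rewrite big_ord0 powR1 invr1 subrr.
rewrite big_ord_recr/=; have := weight_telescope n; rewrite [e * _]mulrC; lra.
Qed.

(** The weights up to index [n] are all at least [(n + 2)^(- (1 + e))], so a finite weighted series
    forces almost linear growth of the partial sums. *)
Lemma partial_sum_le (g : nat -> \bar R) n : (forall s, 0 <= g s)%E ->
  (\sum_(i < n.+1) g i <=
   (n.+2%:R `^ (1 + e))%:E * \sum_(s <oo) ((weight s)%:E * g s))%E.
Proof.
move=> g0.
have h0 s : (0 <= (weight s)%:E * g s)%E by rewrite mule_ge0// lee_fin weight_ge0.
apply: (@le_trans _ _ ((n.+2%:R `^ (1 + e))%:E * \sum_(i < n.+1) ((weight i)%:E * g i))%E).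
  rewrite ge0_sume_distrr; last by move=> i.
  apply: lee_sum => i _; rewrite muleA -EFinM -[leLHS]mul1e lee_wpmul2r//.
  rewrite lee_fin /weight ler_pdivlMr ?powR_gt0// mul1r.
  apply: ge0_ler_powR; rewrite ?nnegrE//; first by rewrite addr_ge0 ?(ltW e0).
  by rewrite ler_nat !ltnS -ltnS.
rewrite lee_wpmul2l ?lee_fin ?powR_ge0//.
rewrite -(big_mkord predT (fun i => (weight i)%:E * g i)%E).
exact: nneseries_lim_ge.
Qed.

End Weights.

(** * Volume of the reached sets and subexponential growth *)

Section Volume.
Context (R : realType).
Variables (N : network R) (rho : nat).
Hypothesis wfN : wf_network N rho.

Lemma vol_ge0 r : 0 <= vol N rho r.
Proof.
rewrite /vol fsbig_finite/=; last exact: (gball_finite wfN r (comp_refl N rho)).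
rewrite big_seq sumr_ge0// => y.
rewrite in_fset_set; last exact: (gball_finite wfN r (comp_refl N rho)).
by rewrite inE => /gball_comp; exact: cdeg_ge0.
Qed.

Lemma reachE_le_vol s y : powE s N rho y != 0%E ->
  (reachE s N y <= (vol N rho (s + s))%:E)%E.
Proof.
(* The vertex [y] is within distance [s] of the root, and the set reached from [y] within distance
   [s] of [y]; hence the radius [s + s]. *)
move=> /powE_gball ry.
have fin := gball_finite wfN (s + s) (comp_refl N rho).
rewrite /reachE (nneseries_finite fin).
- rewrite /vol -fsumEFin//; apply: lee_fsum => // z /gball_comp rz.
  rewrite (degE_wf wfN rz) /nz; case: ifP => _; last by rewrite mul1e.
  by rewrite mul0e lee_fin (cdeg_ge0 wfN).
- by move=> z; apply: mule_ge0; [exact: nz_ge0|exact: (transport_ge0 (@transport_deg R) N z z)].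
- move=> z nz_; have [->|h] := eqVneq (powE s N y z) 0%E; first by rewrite /nz eqxx mul0e.
  by exfalso; apply: nz_; apply: gball_trans ry _; exact: powE_gball.
Qed.

Lemma reached_mass_le s : 0 < cdeg N rho ->
  (reached_mass N rho s <= (vol N rho (s + s))%:E *
     \sum_(y <oo) (powE s N rho y * massE s N rho y))%E.
Proof.
move=> c0.
have d0 u := transport_ge0 (@transport_deg R) N u u.
have e0 u := transport_ge0 (@transport_en R) N u u.
have q0 := transport_ge0 (@transport_pow R s) N.
have m0 := transport_ge0 (@transport_mass R s) N.
have r0 u := transport_ge0 (@transport_reach R s) N u u.
have cr := comp_refl N rho.
rewrite -nneseries_mull ?lee_fin ?vol_ge0//; last by move=> y; rewrite mule_ge0.
apply: lee_nneseries => [y _ _|y _]; first by apply: mule_ge0; [exact: nz_ge0|exact: mule_ge0].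
have [->|py] := eqVneq (powE s N rho y) 0%E.
  by rewrite /nz eqxx !mul0e mule0.
rewrite {1}/nz (negbTE py) mul1e /massE.
have ry : comp N rho y by apply: gball_comp; exact: powE_gball py.
have rV := reachE_le_vol py.
(* Reversibility makes the root reachable from [y] in [s] steps, and the root has positive degree;
   so the inverse of [reachE] is a genuine one. *)
have rpos : (0 < reachE s N y)%E.
  apply: lt_le_trans (@nneseries_ge_term _
    (fun z => nz (powE s N y z) * degE N z)%E rho _); last first.
    by move=> z; apply: mule_ge0 => //; exact: nz_ge0.
  have pyr : powE s N y rho != 0%E.
    apply/eqP => h; have := powE_rev wfN s cr ry; rewrite h mule0 => /eqP.
    by rewrite mule_eq0 (negbTE py) orbF (degE_wf wfN cr) eqe gt_eqF.
  by rewrite /nz (negbTE pyr) mul1e (degE_wf wfN cr) lte_fin.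
rewrite !einvE//.
have rfin : reachE s N y \is a fin_num.
  by rewrite ge0_fin_numE// (le_lt_trans rV)// ltry.
have pfin := powE_fin wfN s y cr.
move: rV rpos py; rewrite -(fineK rfin) -(fineK pfin) /= !lee_fin !lte_fin eqe.
set V := vol _ _ _; set q := fine (reachE _ _ _); set r := fine (powE _ _ _ _) => qV q_gt0 r0'.
rewrite (degE_wf wfN ry) (enE_wf wfN ry) -!EFinM lee_fin.
set D := cdeg N y; set E := \sum_(_ \in _) _.
have DE : 0 <= D * E.
  by rewrite -lee_fin EFinM -(degE_wf wfN ry) -(enE_wf wfN ry) mule_ge0.
have -> : V * (r * (D * E / r / q)) = V / q * (D * E) by field; rewrite r0' gt_eqF.
by rewrite ler_peMl// ler_pdivlMr// mul1r.
Qed.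

Lemma vol_subexp (e : R) : 0 < e ->
  (fun r : nat => ln (ln (vol N rho r)) / ln r%:R) @ \oo --> (0 : R) ->
  exists r0, forall r, (r0 <= r)%N -> vol N rho r <= expR (r%:R `^ e).
Proof.
move=> e0 /cvgrPdist_le /(_ _ e0)[r0 _ hr0]; exists (maxn r0 2) => r.
rewrite geq_max => /andP[r0r r2].
have := hr0 r r0r; rewrite /= sub0r normrN => h.
have lr : 0 < ln (r%:R : R) by rewrite ln_gt0// ltr1n.
(* For a volume at most one the iterated logarithm is no genuine one, but the bound by an
   exponential is then trivial. *)
have [v1|v1] := leP (vol N rho r) 1.
  by rewrite (le_trans v1)// -expR0 ler_expR powR_ge0.
have v0 : 0 < vol N rho r by apply: lt_trans v1.
have lv : 0 < ln (vol N rho r) by rewrite ln_gt0.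
have {}h : ln (ln (vol N rho r)) <= e * ln r%:R.
  by rewrite -ler_pdivrMr//; apply: le_trans h; exact: ler_norm.
rewrite -[leLHS]lnK ?posrE// ler_expR -[leLHS]lnK ?posrE//.
by rewrite /powR gt_eqF ?ler_expR// ltr0n; exact: ltnW.
Qed.

End Volume.

(** * Choice of the parameters and conclusion *)

Lemma polynomial_growth_bound (R : realType) (A B e delta : R) (w : nat -> R) (n1 : nat) :
  0 <= A -> 0 <= B -> 0 < e -> e <= 1 / 4 -> 4 * e <= delta ->
  (forall n (L t : R), (n1 <= n)%N -> (0 < n)%N -> 0 < L -> t = (n + n)%:R `^ e ->
     w n <= 1 + 3 * L * (n.+2%:R `^ (1 + e) * A) + n%:R ^+ 4 * (16 * expR (1 - L / 32)) *
        (n.+2%:R `^ (1 + e) * A + expR t * (n.+2%:R `^ (1 + e) * B))) ->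
  exists n0, forall n, (n0 <= n)%N -> w n <= n%:R `^ (1 + delta).
Proof.
move=> A0 B0 e0 e1 ed wn.
pose C : R := 1 + 16 * (A + B) + 96 * A * (3 + 8 / e).
have C1 : 1 <= C.
  have e8 : 0 <= 8 / e by rewrite divr_ge0// ltW.
  have : 0 <= A * (3 + 8 / e) by rewrite mulr_ge0// addr_ge0.
  by rewrite /C; lra.
(* Beyond [k] one has [9 * C <= n^(2 e)], so the constants are absorbed in a small power of [n]. *)
have [k kC] : exists k : nat, (9 * C) `^ ((2 * e)^-1) <= k%:R.
  exists (Num.bound ((9 * C) `^ ((2 * e)^-1))); apply/ltW; apply: archi_boundP; exact: powR_ge0.
exists (maxn n1 k.+1) => n; rewrite geq_max => /andP[n1n kn].
have n0 : (0 < n)%N by exact: leq_ltn_trans kn.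
pose m : R := n.+2%:R; pose t : R := (n + n)%:R `^ e.
have m1 : 1 <= m by rewrite ler1n.
have m0 : 0 < m by apply: lt_le_trans m1.
have nR : 1 <= n%:R :> R by rewrite ler1n.
have mE : m = n%:R + 2 by rewrite /m -addn2 natrD.
have nm : n%:R <= m by rewrite mE lerDl.
have lm : 0 <= ln m by rewrite ln_ge0.
have t0 : 0 <= t by exact: powR_ge0.
(* Then [exp (1 - L / 32) = exp (- t) * m^(-8)]: the first factor cancels the volume, the second
   both [n^4] and the weight [m^(1 + e) <= m^4]. *)
pose L := 32 * (1 + t + 8 * ln m).
have L0 : 0 < L by rewrite /L mulr_gt0// -addrA ltr_pwDl// addr_ge0// mulr_ge0.
have := wn n L t n1n n0 L0 erefl; rewrite -/m => /le_trans; apply.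
clearbody m.
have eL : expR (1 - L / 32) = expR (- t) * m ^- 8.
  have -> : 1 - L / 32 = - t + - (8 * ln m) by rewrite /L; field.
  by rewrite expRD [expR (- (8 * _))]expRN [8 * ln m]mulr_natl -lnXn// lnK// posrE exprn_gt0.
set W := m `^ (1 + e).
have W0 : 0 <= W by exact: powR_ge0.
have W4 : W <= m ^+ 4.
  rewrite -powR_mulrn ?(ltW m0)//; apply: ler_powR => //; lra.
have err : n%:R ^+ 4 * (16 * expR (1 - L / 32)) * (W * A + expR t * (W * B)) <= 16 * (A + B).
  rewrite eL.
  have -> : n%:R ^+ 4 * (16 * (expR (- t) * m ^- 8)) * (W * A + expR t * (W * B)) =
     16 * ((n%:R ^+ 4 * W * m ^- 8) * (expR (- t) * A + (expR (- t) * expR t) * B)) by ring.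
  rewrite -expRD addNr expR0 mul1r ler_wpM2l//.
  have AB0 : 0 <= expR (- t) * A + B by rewrite addr_ge0// mulr_ge0// expR_ge0.
  apply: (@le_trans _ _ (expR (- t) * A + B)).
    rewrite ler_piMl// ler_pdivrMr ?exprn_gt0// mul1r.
    have -> : m ^+ 8 = m ^+ 4 * m ^+ 4 by rewrite -exprD.
    by rewrite ler_pM ?exprn_ge0// ler_pXn2r ?nnegrE// ltW.
  rewrite lerD2r ler_piMl// -expR0 ler_expR; lra.
have me1 : 1 <= m `^ e by rewrite -[leLHS](powRr0 m); apply: ler_powR => //; exact: ltW.
have tm : t <= 2 * m `^ e.
  apply: (@le_trans _ _ ((2 * m) `^ e)).
    apply: ge0_ler_powR; rewrite ?nnegrE ?(ltW e0)//; first by rewrite mulr_ge0// ltW.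
    by rewrite natrD mE; lra.
  rewrite powRM ?(ltW m0)// ler_wpM2r ?powR_ge0//.
  by rewrite -[leRHS]powRr1//; apply: ler_powR; lra.
have lnm : ln m <= m `^ e / e.
  rewrite ler_pdivlMr// mulrC -ln_powR; apply: ltW; apply: ln_sublinear.
  by rewrite powR_gt0.
have main : 3 * L * (W * A) <= 96 * A * (3 + 8 / e) * m `^ (1 + 2 * e).
  have -> : m `^ (1 + 2 * e) = W * m `^ e.
    rewrite /W -powRD; first by congr (_ `^ _); lra.
    by apply/implyP; rewrite (gt_eqF m0).
  have -> : 3 * L * (W * A) = 96 * A * W * (1 + t + 8 * ln m) by rewrite /L; ring.
  have -> : 96 * A * (3 + 8 / e) * (W * m `^ e) =
    96 * A * W * (m `^ e + 2 * m `^ e + 8 * (m `^ e / e)) by ring.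
  rewrite ler_wpM2l ?mulr_ge0//; lra.
have mge : 1 <= m `^ (1 + 2 * e).
  by rewrite -[leLHS](powRr0 m); apply: ler_powR => //; lra.
apply: (@le_trans _ _ (C * m `^ (1 + 2 * e))).
  apply: (le_trans (lerD (lerD (lexx 1) main) err)).
  rewrite /C; set X := 96 * A * _; set Y := m `^ _.
  have : 0 <= (1 + 16 * (A + B)) * (Y - 1) by rewrite mulr_ge0 ?subr_ge0//; lra.
  lra.
(* Here [m = n + 2 <= 3 n], and [3^(1 + 2 e) <= 9] because [1 + 2 e <= 2]. *)
have n3 : m `^ (1 + 2 * e) <= 9 * n%:R `^ (1 + 2 * e).
  apply: (@le_trans _ _ ((3 * n%:R) `^ (1 + 2 * e))).
    apply: ge0_ler_powR; rewrite ?nnegrE; try lra.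
  rewrite powRM// ?ler_wpM2r ?powR_ge0//.
  have -> : 9 = 3 `^ 2 :> R by rewrite powR_mulrn//; lra.
  by apply: ler_powR; lra.
have n2e : 9 * C <= n%:R `^ (2 * e).
  have -> : 9 * C = ((9 * C) `^ ((2 * e)^-1)) `^ (2 * e).
    by rewrite -powRrM mulVf ?powRr1//; lra.
  apply: ge0_ler_powR; rewrite ?nnegrE ?powR_ge0//; first lra.
  by apply: (le_trans kC); rewrite ler_nat ltnW.
apply: (@le_trans _ _ (n%:R `^ (2 * e) * n%:R `^ (1 + 2 * e))).
  apply: (@le_trans _ _ (9 * C * n%:R `^ (1 + 2 * e))).
    rewrite [9 * C]mulrC -mulrA ler_wpM2l//; lra.
  by rewrite ler_wpM2r ?powR_ge0.
rewrite -powRD; last by apply/implyP; rewrite gt_eqF//; lra.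
by apply: ler_powR => //; lra.
Qed.

(** The deterministic part for a single network: finite weighted series bound energy and mass up to
    time [n], subexponential volume bounds the ball of radius [2 n], and [polynomial_growth_bound]
    chooses [L]. *)
Lemma quenched_almost_diffusive (R : realType) (N : network R) (rho : nat) (e delta : R) :
  wf_network N rho -> 0 < e -> e <= 1 / 4 -> 4 * e <= delta -> 0 < cdeg N rho ->
  (\sum_(s <oo) ((weight e s)%:E * mean_energy N rho s) < +oo)%E ->
  (\sum_(s <oo) ((weight e s)%:E * \sum_(y <oo) (powE s N rho y * massE s N rho y)) < +oo)%E ->
  (fun r : nat => ln (ln (vol N rho r)) / ln r%:R) @ \oo --> (0 : R) ->
  exists n0 : nat, forall n : nat, (n0 <= n)%N ->
     walkE N n rho (fun s => \big[Num.max/0]_(x <- s) wdist N rho x ^+ 2)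
     <= n%:R `^ (1 + delta).
Proof.
move=> wfN e0 e1 ed c0.
set SA := (\sum_(s <oo) _)%E => SAfin; set SB := (\sum_(s <oo) _)%E => SBfin vlim.
have q0 s := transport_ge0 (@transport_pow R s) N.
have en0 u := transport_ge0 (@transport_en R) N u u.
have m0 s := transport_ge0 (@transport_mass R s) N.
have w0 s : (0 <= (weight e s)%:E)%E by rewrite lee_fin weight_ge0.
have A0 s : (0 <= mean_energy N rho s)%E by apply: nneseries_ge0 => y _ _; exact: mule_ge0.
have B0 s : (0 <= \sum_(y <oo) (powE s N rho y * massE s N rho y))%E.
  by apply: nneseries_ge0 => y _ _; exact: mule_ge0.
have SA0 : (0 <= SA)%E by apply: nneseries_ge0 => s _ _; exact: mule_ge0.
have SB0 : (0 <= SB)%E by apply: nneseries_ge0 => s _ _; exact: mule_ge0.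
have SAE : SA = (fine SA)%:E by rewrite fineK// ge0_fin_numE.
have SBE : SB = (fine SB)%:E by rewrite fineK// ge0_fin_numE.
have [r0 vr0] := vol_subexp e0 vlim.
apply: (@polynomial_growth_bound R (fine SA) (fine SB / cdeg N rho) e delta _ r0) => //.
- exact: fine_ge0.
- by rewrite divr_ge0 ?fine_ge0// ltW.
move=> n L t r0n n0 L0 tE.
have HA : (\sum_(i < n.+1) mean_energy N rho i <= (n.+2%:R `^ (1 + e) * fine SA)%:E)%E.
  by apply: (le_trans (partial_sum_le e0 n A0)); rewrite -/SA {1}SAE EFinM.
have HB : (\sum_(i < n.+1) reached_mass N rho i <=
    (vol N rho (n + n) * (n.+2%:R `^ (1 + e) * fine SB))%:E)%E.
  apply: (@le_trans _ _ (\sum_(i < n.+1) ((vol N rho (n + n))%:E *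
       \sum_(y <oo) (powE i N rho y * massE i N rho y)))%E).
    apply: lee_sum => i _; apply: (le_trans (reached_mass_le wfN i c0)).
    rewrite lee_wpmul2r// lee_fin (vol_le wfN)//.
    by rewrite leq_add// -ltnS.
  rewrite -ge0_sume_distrr//.
  rewrite EFinM lee_wpmul2l ?lee_fin ?(vol_ge0 wfN)//.
  by apply: (le_trans (partial_sum_le e0 n B0)); rewrite -/SB {1}SBE EFinM.
apply: (le_trans (quenched_bound wfN c0 n0 L0 HA HB)).
rewrite lerD2l; apply: ler_wpM2l; first by rewrite !mulr_ge0 ?exprn_ge0 ?expR_ge0.
rewrite lerD2l -!mulrA ler_wpM2r//.
  by rewrite mulr_ge0 ?powR_ge0// divr_ge0 ?fine_ge0// ltW.
by rewrite tE; apply: vr0; exact: leq_trans (leq_addr _ _).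
Qed.

Theorem theorem1p5 (R : realType) (d : measure_display) (Omega : measurableType d)
  (P : probability Omega R) (net : Omega -> network R) (rt : Omega -> nat) :
  random_network net rt ->
  reversible P net rt ->
  (\int[P]_w ((cdeg (net w) (rt w))^-1)%:E < +oo)%E ->
  {ae P, forall w,
     (fun r : nat => ln (ln (vol (net w) (rt w) r)) / ln r%:R) @ \oo --> (0 : R)} ->
  (\int[P]_w (\sum_(y \in nbrs (net w) (rt w))
                 step (net w) (rt w) y * wt (net w) (rt w) y ^+ 2)%:E < +oo)%E ->
  forall delta : R, 0 < delta ->
  {ae P, forall w, exists n0 : nat, forall n : nat, (n0 <= n)%N ->
     walkE (net w) n (rt w)
       (fun s => \big[Num.max/0]_(x <- s) wdist (net w) (rt w) x ^+ 2)
     <= n%:R `^ (1 + delta)}.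
Proof.
move=> rnet rev _ vlim efin delta delta0.
(* The exponent loses [4 * e] in all, and the growth estimate needs [e <= 1 / 4]. *)
pose e : R := Num.min delta 1 / 4.
have min0 : 0 < Num.min delta 1 by rewrite lt_min delta0 ltr01.
have e0 : 0 < e by rewrite divr_gt0.
have e1 : e <= 1 / 4 by rewrite ler_pM2r ?invr_gt0// ge_min lexx orbT.
have ed : 4 * e <= delta.
  have -> : 4 * e = Num.min delta 1 by rewrite /e; field.
  by rewrite ge_min lexx.
have Efin : (root_energy P net rt < +oo)%E.
  move: efin; rewrite /root_energy; congr (_ < _)%E; apply: eq_integral => w _.
  by rewrite (enE_wf (@rt_wf _ _ _ _ _ rnet w))//; exact: comp_refl.
have q0 s := transport_ge0 (@transport_pow R s).
have en0 N u := transport_ge0 (@transport_en R) N u u.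
have m0 s := transport_ge0 (@transport_mass R s).
have aeA : {ae P, forall w, (\sum_(s <oo) ((weight e s)%:E *
    mean_energy (net w) (rt w) s) < +oo)%E}.
  apply: (weighted_ae_finite (P := P) (net := net) (rt := rt)
    (g := fun s w => mean_energy (net w) (rt w) s)) => //.
  - by move=> s w; apply: nneseries_ge0 => y _ _; exact: mule_ge0.
  - move=> s; apply: (measurable_rooted rnet
      (F := fun N u v => \sum_(y <oo) (powE s N u y * enE N y))%E).
    exact: transport_comp (@transport_pow R s) (@local_pow R s) (@transport_en R).
  - by move=> s; exact: energy_stationary.
  - by move=> s; exact: weight_ge0.
  - exact: weight_summable.
have aeB : {ae P, forall w, (\sum_(s <oo) ((weight e s)%:E *
    \sum_(y <oo) (powE s (net w) (rt w) y * massE s (net w) (rt w) y)) < +oo)%E}.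
  apply: (weighted_ae_finite (P := P) (net := net) (rt := rt)
    (g := fun s w => \sum_(y <oo) (powE s (net w) (rt w) y * massE s (net w) (rt w) y))%E) => //.
  - by move=> s w; apply: nneseries_ge0 => y _ _; exact: mule_ge0.
  - move=> s; apply: (measurable_rooted rnet
      (F := fun N u v => \sum_(y <oo) (powE s N u y * massE s N v y))%E).
    apply: transport_comp (@transport_pow R s) (@local_pow R s) _.
    exact: transport_tr (@transport_mass R s).
  - by move=> s; exact: mass_stationary.
  - by move=> s; exact: weight_ge0.
  - exact: weight_summable.
have [c0 _] := rev.
(* Four almost sure properties are intersected once and for all, before [n] is chosen, which gives a
   single exceptional null set. *)
apply: filterS3 aeA aeB (filterI c0 vlim) => w hA hB [cw vw].
exact: (quenched_almost_diffusive (@rt_wf _ _ _ _ _ rnet w) e0 e1 ed cw hA hB vw).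
Qed.
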